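(* Let $G$ be a connected locally finite graph, let $N$ be a tree of tangles of $G$, and let $((A_i,B_i))_{i\in\mathbb N}$ be a strictly increasing sequence of oriented separations each of whose underlying separations lies in $N$, with limit $(A,B)=(\bigcup_i A_i,\bigcap_i B_i)$. If $B\neq\emptyset$, then $G$ has exactly one end that lies in the closure of $A\cap B$, and this end is thick.
   Context: A separation of $G$ is an unordered pair $\{A,B\}$ of subsets of $V(G)$ with $A\cup B=V(G)$ such that no edge of $G$ joins $A\setminus B$ to $B\setminus A$; its order is $|A\cap B|$. Its orientations are $(A,B)$ and $(B,A)$, partially ordered by $(A,B)\le (C,D)$ iff $A\subseteq C$ and $B\supseteq D$; strictly increasing means $(A_i,B_i)<(A_{i+1},B_{i+1})$ for all $i$. Two separations are nested if some orientations of them are comparable; a set of separations is nested if its elements are pairwise nested. A set $O$ of oriented separations is consistent if there are no $(A,B),(C,D)\in O$ with $\{A,B\}\ne\{C,D\}$ and $(B,A)\le(C,D)$. A pre-tangle is a consistent set $P$ which, for some $k\in\mathbb N\cup\{\aleph_0\}$, contains exactly one orientation of each separation of order $<k$ and nothing else. A tangle is a pre-tangle $P$ such that $G[A_1]\cup G[A_2]\cup G[A_3]\neq G$ for any $(A_1,B_1),(A_2,B_2),(A_3,B_3)\in P$. A separation distinguishes two tangles if both orient it but differently; efficiently if it has minimal order among such separations. A tree of tangles of $G$ is a nested set $N$ of separations such that every two tangles distinguished by some separation are efficiently distinguished by some element of $N$, and every element of $N$ efficiently distinguishes some two tangles. An end of $G$ is an equivalence class of rays (equivalent if not separated by a finite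 vertex set); it is thick if it contains infinitely many disjoint rays. A comb is the union of a ray $R$ (its spine) with infinitely many disjoint finite paths having exactly their first vertex on $R$; their last vertices are the teeth. An end $\omega$ lies in the closure of $U\subseteq V(G)$ if $G$ contains a comb with all teeth in $U$ whose spine belongs to $\omega$. *)

(* Defs.v *)
From Stdlib Require Import List Arith.
Import ListNotations.

Section Defs.
Variable V : Type.
Variable adj : V -> V -> Prop.

Definition vset := V -> Prop.
Definition osep := (vset * vset)%type.

Definition set_eq (X Y : vset) : Prop := forall v, X v <-> Y v.
Definition finite_set (X : vset) : Prop := exists l : list V, forall v, X v -> In v l.
Definition has_card (X : vset) (n : nat) : Prop :=
  exists l : list V, NoDup l /\ length l = n /\ forall v, X v <-> In v l.

Definition simple_graph : Prop :=
  (forall u v, adj u v -> adj v u) /\ (forall v, ~ adj v v).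
Definition locally_finite : Prop := forall v, finite_set (adj v).

Fixpoint walk (l : list V) : Prop :=
  match l with
  | x :: ((y :: _) as t) => adj x y /\ walk t
  | _ => True
  end.
Definition is_path (l : list V) : Prop := l <> [] /\ NoDup l /\ walk l.
Definition connected : Prop :=
  forall x y, exists l, is_path l /\ hd x l = x /\ last l x = y.

Definition is_sep (A B : vset) : Prop :=
  (forall v, A v \/ B v) /\
  (forall u v, adj u v -> ~ ((A u /\ ~ B u) /\ (B v /\ ~ A v))).
(* order |A cap B| < k, with k : option nat, None standing for aleph_0 *)
Definition order_lt (A B : vset) (k : option nat) : Prop :=
  exists n, has_card (fun v => A v /\ B v) n /\
    match k with None => True | Some m => n < m end.
(* |A cap B| <= |C cap D| (only finite vs finite / infinite matters here) *)
Definition ord_le (A B C D : vset) : Prop :=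
  forall n, has_card (fun v => C v /\ D v) n ->
    exists m, has_card (fun v => A v /\ B v) m /\ m <= n.

Definition ole (s t : osep) : Prop :=
  (forall v, fst s v -> fst t v) /\ (forall v, snd t v -> snd s v).
Definition olt (s t : osep) : Prop :=
  ole s t /\ ~ (set_eq (fst s) (fst t) /\ set_eq (snd s) (snd t)).
Definition same_sep (s t : osep) : Prop :=
  (set_eq (fst s) (fst t) /\ set_eq (snd s) (snd t)) \/
  (set_eq (fst s) (snd t) /\ set_eq (snd s) (fst t)).
Definition flip (s : osep) : osep := (snd s, fst s).

Definition nested_sep (s t : osep) : Prop :=
  ole s t \/ ole s (flip t) \/ ole (flip s) t \/ ole (flip s) (flip t).

Definition consistent (O : osep -> Prop) : Prop :=
  forall s t, O s -> O t -> ~ same_sep s t -> ~ ole (flip s) t.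

Definition pre_tangle (P : osep -> Prop) : Prop :=
  consistent P /\
  exists k : option nat,
    (forall s, P s -> is_sep (fst s) (snd s) /\ order_lt (fst s) (snd s) k) /\
    (forall A B, is_sep A B -> order_lt A B k -> P (A, B) \/ P (B, A)) /\
    (forall s t, P s -> P t -> same_sep s t ->
       set_eq (fst s) (fst t) /\ set_eq (snd s) (snd t)).

(* G[A1] cup G[A2] cup G[A3] = G *)
Definition covers3 (A1 A2 A3 : vset) : Prop :=
  (forall v, A1 v \/ A2 v \/ A3 v) /\
  (forall u v, adj u v ->
     (A1 u /\ A1 v) \/ (A2 u /\ A2 v) \/ (A3 u /\ A3 v)).

Definition tangle (P : osep -> Prop) : Prop :=
  pre_tangle P /\
  forall s1 s2 s3, P s1 -> P s2 -> P s3 -> ~ covers3 (fst s1) (fst s2) (fst s3).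

Definition distinguishes (P Q : osep -> Prop) (s : osep) : Prop :=
  exists p q, P p /\ Q q /\ same_sep p s /\ same_sep q s /\
    ~ (set_eq (fst p) (fst q) /\ set_eq (snd p) (snd q)).
Definition eff_distinguishes (P Q : osep -> Prop) (s : osep) : Prop :=
  distinguishes P Q s /\
  forall t, distinguishes P Q t -> ord_le (fst s) (snd s) (fst t) (snd t).

(* a set N of (unordered) separations is given by a predicate on oriented
   separations; {A,B} lies in N iff (A,B) or (B,A) satisfies it *)
Definition sep_in (N : osep -> Prop) (s : osep) : Prop := N s \/ N (flip s).

Definition nested_set (N : osep -> Prop) : Prop :=
  forall s t, sep_in N s -> sep_in N t -> nested_sep s t.

Definition tree_of_tangles (N : osep -> Prop) : Prop :=
  nested_set N /\
  (forall P Q, tangle P -> tangle Q -> (exists s, distinguishes P Q s) ->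
     exists s, sep_in N s /\ eff_distinguishes P Q s) /\
  (forall s, sep_in N s ->
     exists P Q, tangle P /\ tangle Q /\ eff_distinguishes P Q s).

Definition is_ray (R : nat -> V) : Prop :=
  (forall m n, R m = R n -> m = n) /\ (forall n, adj (R n) (R (S n))).
Definition on_ray (R : nat -> V) (v : V) : Prop := exists n, R n = v.

Definition ray_equiv (R1 R2 : nat -> V) : Prop :=
  forall X, finite_set X ->
    exists m n l,
      (forall m', m <= m' -> ~ X (R1 m')) /\
      (forall n', n <= n' -> ~ X (R2 n')) /\
      is_path l /\ hd (R1 m) l = R1 m /\ last l (R1 m) = R2 n /\
      (forall v, In v l -> ~ X v).

Definition is_end (om : (nat -> V) -> Prop) : Prop :=
  exists R, is_ray R /\ forall R', om R' <-> (is_ray R' /\ ray_equiv R R').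

Definition thick (om : (nat -> V) -> Prop) : Prop :=
  exists Rs : nat -> nat -> V,
    (forall i, om (Rs i)) /\
    (forall i j, i <> j -> forall m n, Rs i m <> Rs j n).

(* comb with spine R and paths P i; teeth = last vertices, in U *)
Definition is_comb (R : nat -> V) (P : nat -> list V) (U : vset) : Prop :=
  is_ray R /\
  (forall i, is_path (P i)) /\
  (forall i, on_ray R (hd (R 0) (P i))) /\
  (forall i v, In v (tl (P i)) -> ~ on_ray R v) /\
  (forall i j v, i <> j -> In v (P i) -> ~ In v (P j)) /\
  (forall i, U (last (P i) (R 0))).

Definition in_closure (om : (nat -> V) -> Prop) (U : vset) : Prop :=
  exists R P, om R /\ is_comb R P U.

Definition lim_sep (s : nat -> osep) : osep :=
  (fun v => exists i, fst (s i) v, fun v => forall i, snd (s i) v).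

End Defs.

Arguments set_eq {V}.
Arguments olt {V}.
Arguments lim_sep {V}.
Arguments sep_in {V}.

(* Main.v *)
Require Import Defs.
From Stdlib Require Import List Arith Lia Classical ClassicalEpsilon.
From Stdlib Require Import FunctionalExtensionality PropExtensionality.
Import ListNotations.

(* Every A_i ∩ B_i is an efficient separator of two tangles. Hence it is the full
   neighbourhood of a component on either side, and by submodularity a separation
   {E, F} of order m cannot have more than m of its vertices in E \ F and more than m
   in F \ E. Both facts pass to U = A ∩ B. By the first, U is infinite, because a
   finite U would be equal to two consecutive separators of the chain. By the second,
   every finite vertex set S leaves exactly one component of G - S with infinitely
   many vertices of U, so U has exactly one end in its closure, and a set S which
   separates a set T of vertices of U from this end has at least |T| / 2 vertices.
   Minimum-size separators of growing finite sets from the end therefore grow in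
   size, and by Menger's theorem each can be linked completely to the next one;
   joining these linkages gives infinitely many disjoint rays of the end. *)

(** The second fact is quantitative on purpose. That no finite separation leaves infinitely many
    vertices of U on both sides would already give a unique end; the bound by m is what makes the
    separators grow and so yields thickness. It survives the limit without any bound on the orders
    in the chain: one instance concerns finitely many vertices of U, which lie in B and hence in
    every B_i, and which lie in A_i for all large i. From there on tangles are forgotten; only an
    infinite set U with this bound is left.

    Each linkage is finite, so infinitely many rays must come from new starting vertices: as the
    separators grow strictly, each has a vertex in which no path of the previous linkage ends, and a
    ray starts there. *)

(** * Classical choice and finite sets *)

Definition classical_eq_dec {T : Type} (x y : T) : {x = y} + {x <> y} :=
  excluded_middle_informative (x = y).

Lemma choice_on {S T : Type} (D : S -> Prop) (Q : S -> T -> Prop) (t0 : T) :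
  (forall x, D x -> exists y, Q x y) -> exists f, forall x, D x -> Q x (f x).
Proof.
  intros H.
  assert (H' : forall x, exists y, D x -> Q x y).
  { intros x. destruct (classic (D x)) as [d|d].
    - destruct (H x d) as [y Hy]. exists y. auto.
    - exists t0. tauto. }
  exists (fun x => proj1_sig (constructive_indefinite_description _ (H' x))).
  intros x. exact (proj2_sig (constructive_indefinite_description _ (H' x))).
Qed.

Lemma many_or_few {T : Type} (Q : T -> Prop) (k : nat) :
  (exists l, NoDup l /\ length l = k /\ forall v, In v l -> Q v) \/
  (exists l, length l < k /\ forall v, Q v -> In v l).
Proof.
  induction k as [|k [(l & nd & len & Hl)|(l & len & Hl)]].
  - left. exists []. split; [constructor|split; [auto|intros v []]].
  - destruct (classic (exists v, Q v /\ ~ In v l)) as [(v & qv & nv)|no].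
    + left. exists (v :: l). split; [constructor; auto|split; [simpl; lia|]].
      intros w [<-|h]; auto.
    + right. exists l. split; [lia|]. intros v qv.
      apply NNPP. intros nv. apply no. eauto.
  - right. exists l. split; [lia|auto].
Qed.

Lemma infinite_many {T : Type} (Q : T -> Prop) (k : nat) :
  ~ finite_set T Q -> exists l, NoDup l /\ length l = k /\ forall v, In v l -> Q v.
Proof.
  intros inf. destruct (many_or_few Q k) as [h|(l & _ & Hl)]; [exact h|].
  exfalso. apply inf. exists l. exact Hl.
Qed.

Lemma finite_subset {T : Type} (Q Q' : T -> Prop) :
  finite_set T Q' -> (forall v, Q v -> Q' v) -> finite_set T Q.
Proof. intros [l Hl] h. exists l. auto. Qed.

Lemma finite_set_enum {T : Type} (Q : T -> Prop) (l : list T) :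
  (forall v, Q v -> In v l) ->
  exists l', NoDup l' /\ length l' <= length l /\ forall v, Q v <-> In v l'.
Proof.
  intros H.
  set (b := fun v => if excluded_middle_informative (Q v) then true else false).
  exists (filter b (nodup classical_eq_dec l)). split; [|split].
  - apply NoDup_filter, NoDup_nodup.
  - etransitivity; [apply filter_length_le|].
    apply NoDup_incl_length; [apply NoDup_nodup|].
    intros v. apply nodup_In.
  - intros v. rewrite filter_In, nodup_In. unfold b.
    destruct (excluded_middle_informative (Q v)) as [q|q]; split;
      [auto|auto|tauto|intros [_ h]; discriminate].
Qed.

Lemma finite_card {T : Type} (Q : T -> Prop) (l : list T) :
  (forall v, Q v -> In v l) -> exists n, has_card T Q n /\ n <= length l.
Proof.
  intros H. destruct (finite_set_enum Q l H) as (l' & nd & len & Hl').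
  exists (length l'). split; [|exact len]. exists l'. auto.
Qed.

Lemma has_card_unique {T : Type} (Q : T -> Prop) (m n : nat) :
  has_card T Q m -> has_card T Q n -> m = n.
Proof.
  intros (l & nd & <- & Hl) (l' & nd' & <- & Hl').
  apply Nat.le_antisymm; apply NoDup_incl_length; auto;
    intros v h; [apply Hl', Hl, h|apply Hl, Hl', h].
Qed.

Lemma finite_union {T I : Type} (L : list I) (F : I -> T -> Prop) :
  (forall i, In i L -> finite_set T (F i)) ->
  finite_set T (fun v => exists i, In i L /\ F i v).
Proof.
  induction L as [|i L IH]; intros H.
  - exists []. intros v (i & [] & _).
  - destruct IH as [l Hl]; [intros; apply H; simpl; auto|].
    destruct (H i) as [l' Hl']; [simpl; auto|].
    exists (l' ++ l). intros v (j & [<-|hj] & h); apply in_or_app; eauto.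
Qed.

(** * Walks *)

Lemma NoDup_app_disjoint {T : Type} (l l' : list T) (v : T) :
  NoDup (l ++ l') -> In v l -> In v l' -> False.
Proof.
  induction l as [|a l IH]; simpl; [tauto|].
  intros nd h h'. inversion nd as [|? ? na nd']. subst.
  destruct h as [<-|h]; [|auto]. apply na, in_or_app. auto.
Qed.

Lemma last_cons_default {T : Type} (x : T) (l : list T) (d d' : T) :
  last (x :: l) d = last (x :: l) d'.
Proof. revert x; induction l as [|y l IH]; intros x; [reflexivity|exact (IH y)]. Qed.

Section Walks.
Context {V : Type}.
Implicit Types (R : V -> V -> Prop) (P : V -> Prop).

(** Vertices may repeat and [R] need not be symmetric. Thus one notion serves the graph itself,
    finite lists of directed edges, and walks restricted by a condition on their edges. *)
Inductive rwalk R : V -> list V -> V -> Prop :=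
| rwalk_one a : rwalk R a [a] a
| rwalk_cons a b l c : R a b -> rwalk R b l c -> rwalk R a (a :: l) c.

Lemma rwalk_mono R R' a l b :
  rwalk R a l b -> (forall u v, R u v -> R' u v) -> rwalk R' a l b.
Proof. intros H h. induction H; econstructor; eauto. Qed.

Lemma rwalk_start R a l b : rwalk R a l b -> In a l.
Proof. intros H. destruct H; simpl; auto. Qed.

Lemma rwalk_end R a l b : rwalk R a l b -> In b l.
Proof. intros H. induction H; simpl; auto. Qed.

Lemma rwalk_link R a l b c l' d :
  rwalk R a l b -> R b c -> rwalk R c l' d -> rwalk R a (l ++ l') d.
Proof. intros H; induction H; intros; simpl; econstructor; eauto. Qed.

Lemma rwalk_app R a l b l' c :
  rwalk R a l b -> rwalk R b l' c -> rwalk R a (l ++ tl l') c.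
Proof.
  intros H H'. destruct H' as [b|b d l' c r H'].
  - simpl. rewrite app_nil_r. exact H.
  - simpl. exact (rwalk_link _ _ _ _ _ _ _ H r H').
Qed.

Lemma rwalk_split R a l b v : rwalk R a l b -> In v l ->
  exists l1 l2, rwalk R a l1 v /\ rwalk R v l2 b /\ l = l1 ++ tl l2.
Proof.
  intros H; induction H as [a|a b l c r H IH]; intros h.
  - destruct h as [<-|[]]. exists [a], [a]. repeat split; constructor.
  - destruct h as [<-|h].
    + exists [a], (a :: l). repeat split; econstructor; eauto.
    + destruct (IH h) as (l1 & l2 & h1 & h2 & ->).
      exists (a :: l1), l2. repeat split; [econstructor; eauto|auto].
Qed.

Lemma rwalk_tl_end R a l b : rwalk R a l b -> a = b \/ In b (tl l).
Proof. intros H. destruct H; simpl; eauto using rwalk_end. Qed.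

Lemma rwalk_cases R a l b : rwalk R a l b -> exists l', l = a :: l'.
Proof. intros H. destruct H; eauto. Qed.

(** The restricted relation records that all vertices of the segment except its last one violate
    [P]; in [rwalk_last] all except the first one do. *)
Lemma rwalk_first R P a l b : rwalk R a l b -> (exists v, In v l /\ P v) ->
  exists c l', P c /\ rwalk (fun u w => R u w /\ ~ P u) a l' c /\ incl l' l.
Proof.
  intros H; induction H as [a|a b l c r H IH]; intros (v & hv & pv).
  - destruct hv as [<-|[]]. exists a, [a].
    repeat split; auto using incl_refl. constructor.
  - destruct (classic (P a)) as [pa|npa].
    + exists a, [a]. repeat split; auto; [constructor|].
      intros x [<-|[]]; simpl; auto.
    + destruct hv as [<-|hv]; [tauto|].
      destruct IH as (d & l' & pd & hd & i); [eauto|].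
      exists d, (a :: l'). split; [auto|split; [econstructor; eauto|]].
      intros x [<-|hx]; simpl; auto.
Qed.

Lemma rwalk_last R P a l b : rwalk R a l b -> (exists v, In v l /\ P v) ->
  exists c l', P c /\ rwalk (fun u w => R u w /\ ~ P w) c l' b /\ incl l' l.
Proof.
  intros H; induction H as [a|a b l c r H IH]; intros (v & hv & pv).
  - destruct hv as [<-|[]]. exists a, [a].
    repeat split; auto using incl_refl. constructor.
  - destruct (classic (exists w, In w l /\ P w)) as [e|ne].
    + destruct (IH e) as (d & l' & pd & hd & i).
      exists d, l'. auto using incl_tl.
    + destruct hv as [<-|hv]; [|exfalso; eauto].
      exists a, (a :: l). split; [auto|split; [|apply incl_refl]].
      assert (K : forall x l' y, rwalk R x l' y -> incl l' l ->
                    rwalk (fun u w => R u w /\ ~ P w) x l' y).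
      { intros x l' y K; induction K as [x|x y l' z r' K IHK]; intros i;
          [constructor|].
        assert (i' : incl l' l) by (intros w hw; apply i; simpl; auto).
        econstructor; [split; [exact r'|]|auto].
        intros py. apply ne. exists y. split; [apply i', (rwalk_start _ _ _ _ K)|auto]. }
      econstructor; [split; [exact r|]|apply K; auto using incl_refl].
      intros pb. apply ne. exists b. split; [exact (rwalk_start _ _ _ _ H)|auto].
Qed.

Lemma rwalk_NoDup R a l b : rwalk R a l b ->
  exists l', rwalk R a l' b /\ NoDup l' /\ incl l' l.
Proof.
  intros H; induction H as [a|a b l c r H (l' & H' & nd & i)].
  - exists [a]. split; [constructor|split; [|apply incl_refl]].
    repeat constructor. intros [].
  - destruct (classic (In a l')) as [ha|ha].
    + assert (K : forall x l1 y, rwalk R x l1 y -> NoDup l1 -> In a l1 ->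
                exists l2, rwalk R a l2 y /\ NoDup l2 /\ incl l2 l1).
      { intros x l1 y K; induction K as [x|x y l1 z r' K IHK]; intros nd1 h1.
        - destruct h1 as [<-|[]]. exists [x].
          repeat split; auto using incl_refl. constructor.
        - destruct h1 as [<-|h1].
          + exists (x :: l1). repeat split; auto using incl_refl.
            econstructor; eauto.
          + destruct IHK as (l2 & h2 & nd2 & i2); auto.
            { inversion nd1; auto. }
            exists l2. auto using incl_tl. }
      destruct (K _ _ _ H' nd ha) as (l2 & h2 & nd2 & i2).
      exists l2. split; [auto|split; [auto|]].
      apply incl_tl. eapply incl_tran; eauto.
    + exists (a :: l'). split; [econstructor; eauto|split; [constructor; auto|]].
      intros x [<-|hx]; simpl; auto.
Qed.

Lemma rwalk_rev R a l b : (forall u v, R u v -> R v u) ->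
  rwalk R a l b -> rwalk R b (rev l) a.
Proof.
  intros sym H; induction H as [a|a b l c r H IH]; simpl; [constructor|].
  eapply rwalk_link; [exact IH|apply sym, r|constructor].
Qed.

Lemma rwalk_hd_last R a l b : rwalk R a l b ->
  l <> [] /\ walk V R l /\ (forall d, hd d l = a) /\ (forall d, last l d = b).
Proof.
  intros H; induction H as [a|a b l c r H (ne & w & h & la)].
  - repeat split; auto. discriminate.
  - destruct l as [|x l]; [congruence|].
    assert (x = b) as -> by exact (h a).
    repeat split; auto. discriminate.
Qed.

Lemma walk_rwalk R a l : walk V R (a :: l) -> rwalk R a (a :: l) (last (a :: l) a).
Proof.
  revert a; induction l as [|b l IH]; intros a H; [constructor|].
  destruct H as [r H]. econstructor; [exact r|].
  change (last (a :: b :: l) a) with (last (b :: l) a).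
  rewrite (last_cons_default b l a b). apply IH, H.
Qed.

End Walks.

(** * Menger's theorem *)

Section Menger.
Context {V : Type}.
Implicit Types (R : V -> V -> Prop) (A B : V -> Prop) (E : list (V * V)).

Definition separates R A B (Y : list V) :=
  forall a l b, A a -> B b -> rwalk R a l b -> exists v, In v Y /\ In v l.

(* The index set of the family of disjoint walks is a list of vertices, so that
   families can be reindexed by their end vertices. *)
Definition linkage R A B (k : nat) :=
  exists (I : list V) (p : V -> list V), NoDup I /\ length I = k /\
    (forall i, In i I -> exists a b, A a /\ B b /\ rwalk R a (p i) b /\ NoDup (p i)) /\
    (forall i j v, In i I -> In j I -> In v (p i) -> In v (p j) -> i = j).

Lemma linkage_intro R A B (I : list V) (p : V -> list V) :
  NoDup I ->
  (forall i, In i I -> exists a b, A a /\ B b /\ rwalk R a (p i) b) ->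
  (forall i j v, In i I -> In j I -> In v (p i) -> In v (p j) -> i = j) ->
  linkage R A B (length I).
Proof.
  intros nd Hp disj.
  assert (H : forall i, In i I -> exists l, incl l (p i) /\
            exists a b, A a /\ B b /\ rwalk R a l b /\ NoDup l).
  { intros i hi. destruct (Hp i hi) as (a & b & ha & hb & w).
    destruct (rwalk_NoDup _ _ _ _ w) as (l & w' & ndl & inc). eauto 10. }
  destruct (choice_on _ _ [] H) as [f Hf].
  exists I, f. repeat split; auto.
  - intros i hi. apply Hf, hi.
  - intros i j v hi hj h h'. apply (disj i j v); auto; apply Hf; auto.
Qed.

Definition edge_in E (u v : V) := In (u, v) E.

(** [mark] selects which end vertex of a walk is the index. Disjoint walks have different marks, so
    k walks use up all k elements of [T], and each element of [T] names exactly one walk. *)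
Lemma linkage_reindex R A B k (T : list V) (mark : V -> V -> V -> Prop) :
  (forall a b, A a -> B b -> exists t, In t T /\ mark t a b) ->
  (forall t a b, mark t a b -> t = a \/ t = b) ->
  length T = k -> linkage R A B k ->
  exists p, (forall t, In t T ->
      exists a b, A a /\ B b /\ mark t a b /\ rwalk R a (p t) b /\ NoDup (p t)) /\
    (forall t t' v, In t T -> In t' T -> In v (p t) -> In v (p t') -> t = t').
Proof.
  intros He Hm len (I & p & nd & lenI & Hp & disj).
  assert (H : forall i, In i I -> exists t, In t T /\ In t (p i) /\
            exists a b, A a /\ B b /\ mark t a b /\ rwalk R a (p i) b /\ NoDup (p i)).
  { intros i hi. destruct (Hp i hi) as (a & b & ha & hb & w).
    destruct w as [w ndw], (He _ _ ha hb) as (t & ht & m).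
    exists t. split; [exact ht|split; [|exists a, b; auto]].
    destruct (Hm _ _ _ m) as [-> | ->]; eauto using rwalk_start, rwalk_end. }
  destruct I as [|i0 I'].
  { assert (T = []) as -> by (apply length_zero_iff_nil; simpl in *; congruence).
    exists p. split; intros t; [intros []|intros t' v []]. }
  set (I := i0 :: I') in *.
  destruct (choice_on _ _ i0 H) as [f Hf].
  assert (nd' : NoDup (map f I)).
  { apply NoDup_map_NoDup_ForallPairs; [|exact nd].
    intros i j hi hj eq. apply (disj i j (f i)); auto.
    - apply Hf, hi.
    - rewrite eq. apply Hf, hj. }
  assert (inc : incl T (map f I)).
  { apply NoDup_length_incl; auto.
    - rewrite length_map. lia.
    - intros t ht. apply in_map_iff in ht as (i & <- & hi). apply Hf, hi. }
  assert (G : forall t, In t T -> exists i, In i I /\ f i = t).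
  { intros t ht. apply inc, in_map_iff in ht as (i & eq & hi). eauto. }
  destruct (choice_on _ _ i0 G) as [g Hg].
  exists (fun t => p (g t)). split.
  - intros t ht. destruct (Hg t ht) as [hi eq].
    destruct (Hf _ hi) as (_ & _ & h). rewrite eq in h. exact h.
  - intros t t' v ht ht' hv hv'.
    destruct (Hg t ht) as [hi eq], (Hg t' ht') as [hi' eq'].
    rewrite <- eq, <- eq'. f_equal. eapply disj; eauto.
Qed.

(** Dropping repetitions leaves a separator, so a list of minimum length has none. *)
Lemma separates_NoDup R A B k Y :
  (forall Z, separates R A B Z -> k <= length Z) ->
  separates R A B Y -> length Y <= k -> NoDup Y.
Proof.
  intros H sep len.
  apply (@NoDup_incl_NoDup V (nodup classical_eq_dec Y)).
  - apply NoDup_nodup.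
  - transitivity k; [exact len|]. apply H. intros a l b ha hb w.
    destruct (sep a l b ha hb w) as (v & hv & hl).
    exists v. now rewrite nodup_In.
  - intros v. apply nodup_In.
Qed.

(* Göring's induction: if deleting the edge (x, y) creates a separator S with
   fewer than k vertices, then S + x and S + y are separators of size k, and
   linkages from A to S + x and from S + y to B avoid the edge (x, y). *)
Lemma menger_edge_list E A B k :
  (forall Y, separates (edge_in E) A B Y -> k <= length Y) ->
  linkage (edge_in E) A B k.
Proof.
  revert A B k. induction E as [|[x y] E IH]; intros A B k H.
  - destruct (many_or_few (fun v => A v /\ B v) k) as [(I & nd & len & HI)|(Y & len & HY)].
    + exists I, (fun v => [v]). repeat split; auto.
      * intros i hi. exists i, i. destruct (HI i hi).
        repeat split; auto; repeat constructor. intros [].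
      * intros i j v _ _ [<-|[]] [<-|[]]. reflexivity.
    + exfalso. enough (k <= length Y) by lia. apply H.
      intros a l b ha hb w. destruct w as [a|a c l b [] w].
      exists a. simpl. auto.
  - assert (mono : forall a l b, rwalk (edge_in E) a l b -> rwalk (edge_in ((x, y) :: E)) a l b).
    { intros a l b w. apply (rwalk_mono _ _ _ _ _ w). intros u v h. right. exact h. }
    destruct (classic (forall Y, separates (edge_in E) A B Y -> k <= length Y)) as [h|h].
    { destruct (IH A B k h) as (I & p & nd & len & Hp & disj).
      exists I, p. repeat split; auto. intros i hi.
      destruct (Hp i hi) as (a & b & ha & hb & w & ndp). exists a, b. auto. }
    apply not_all_ex_not in h as [S h]. apply imply_to_and in h as [sepS lenS].
    assert (avoid_x : forall a l b, rwalk (edge_in ((x, y) :: E)) a l b -> ~ In x l ->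
                rwalk (edge_in E) a l b).
    { intros a l b w. induction w as [a|a c l b r w IHw]; intros nx; [constructor|].
      simpl in nx. econstructor; [|apply IHw; tauto].
      destruct r as [r|r]; [|exact r]. inversion r. subst. tauto. }
    assert (avoid_y : forall a l b, rwalk (edge_in ((x, y) :: E)) a l b -> ~ In y l ->
                rwalk (edge_in E) a l b).
    { intros a l b w. induction w as [a|a c l b r w IHw]; intros ny; [constructor|].
      simpl in ny. econstructor; [|apply IHw; tauto].
      destruct r as [r|r]; [|exact r]. inversion r. subst.
      exfalso. apply ny. right. exact (rwalk_start _ _ _ _ w). }
    assert (sepx : separates (edge_in ((x, y) :: E)) A B (x :: S)).
    { intros a l b ha hb w. destruct (classic (In x l)) as [hx|hx].
      - exists x. simpl. auto.
      - destruct (sepS a l b ha hb (avoid_x _ _ _ w hx)) as (v & hv & hl).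
        exists v. simpl. auto. }
    assert (sepy : separates (edge_in ((x, y) :: E)) A B (y :: S)).
    { intros a l b ha hb w. destruct (classic (In y l)) as [hy|hy].
      - exists y. simpl. auto.
      - destruct (sepS a l b ha hb (avoid_y _ _ _ w hy)) as (v & hv & hl).
        exists v. simpl. auto. }
    assert (lenx : length (x :: S) = k).
    { apply Nat.le_antisymm; [simpl; lia|apply H, sepx]. }
    assert (leny : length (y :: S) = k) by exact lenx.
    assert (ndx : NoDup (x :: S)) by (eapply separates_NoDup; eauto; lia).
    assert (ndy : NoDup (y :: S)) by (eapply separates_NoDup; eauto; lia).
    assert (nx : ~ In x S) by now inversion ndx.
    assert (ny : ~ In y S) by now inversion ndy.
    (* An A-B walk cut off at its first vertex in S + x cannot use the edge (x, y), since it would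
       have met x before. So a separator of A and S + x in [E] also separates A from B. For [L2] the
       walk is cut at its last vertex in S + y. *)
    assert (L1 : linkage (edge_in E) A (fun v => In v (x :: S)) k).
    { apply IH. intros T sepT. apply H. intros a l b ha hb w.
      destruct (rwalk_first _ (fun v => In v (x :: S)) _ _ _ w) as (c & l' & hc & w' & i).
      { destruct (sepx a l b ha hb w) as (v & hv & hl). eauto. }
      destruct (sepT a l' c ha hc) as (v & hv & hl); [|eauto].
      apply (rwalk_mono _ _ _ _ _ w'). intros u v [[r|r] hu]; [|exact r].
      inversion r. subst. simpl in hu. tauto. }
    assert (L2 : linkage (edge_in E) (fun v => In v (y :: S)) B k).
    { apply IH. intros T sepT. apply H. intros a l b ha hb w.
      destruct (rwalk_last _ (fun v => In v (y :: S)) _ _ _ w) as (c & l' & hc & w' & i).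
      { destruct (sepy a l b ha hb w) as (v & hv & hl). eauto. }
      destruct (sepT c l' b hc hb) as (v & hv & hl); [|eauto].
      apply (rwalk_mono _ _ _ _ _ w'). intros u v [[r|r] hu]; [|exact r].
      inversion r. subst. simpl in hu. tauto. }
    destruct (fun h h' => linkage_reindex _ _ _ _ (x :: S) (fun t a b => t = b) h h' lenx L1)
      as (p & Hp & dp); [intros a b _ hb; exists b; auto|auto|].
    destruct (fun h h' => linkage_reindex _ _ _ _ (y :: S) (fun t a b => t = a) h h' leny L2)
      as (q & Hq & dq); [intros a b ha _; exists a; auto|auto|].
    assert (Hp' : forall t, In t (x :: S) ->
              exists a, A a /\ rwalk (edge_in E) a (p t) t /\ NoDup (p t)).
    { intros t ht. destruct (Hp t ht) as (a & b & ha & hb & -> & w). eauto. }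
    assert (Hq' : forall t, In t (y :: S) ->
              exists b, B b /\ rwalk (edge_in E) t (q t) b /\ NoDup (q t)).
    { intros t ht. destruct (Hq t ht) as (a & b & ha & hb & -> & w). eauto. }
    clear Hp Hq.
    assert (endp : forall t v, In t (x :: S) -> In v (x :: S) -> In v (p t) -> t = v).
    { intros t v ht hv h. apply (dp t v v); auto.
      destruct (Hp' v hv) as (a & _ & w & _). exact (rwalk_end _ _ _ _ w). }
    assert (startq : forall t v, In t (y :: S) -> In v (y :: S) -> In v (q t) -> t = v).
    { intros t v ht hv h. apply (dq t v v); auto.
      destruct (Hq' v hv) as (a & _ & w & _). exact (rwalk_start _ _ _ _ w). }
    (* Following [p t] up to v and then [q t'] gives an A-B walk in [E], which must meet S. But
       [p t] meets S at most in its last vertex and [q t'] at most in its first, so the switch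
       happens exactly there. *)
    assert (meet : forall t t' v, In t (x :: S) -> In t' (y :: S) ->
               In v (p t) -> In v (q t') -> v = t /\ v = t').
    { intros t t' v ht ht' hv hv'.
      destruct (Hp' t ht) as (a & ha & wp & np), (Hq' t' ht') as (b & hb & wq & nq).
      destruct (rwalk_split _ _ _ _ _ wp hv) as (l1 & l1' & w1 & w1' & ep).
      destruct (rwalk_split _ _ _ _ _ wq hv') as (l2' & l2 & w2' & w2 & eq).
      assert (K : In v S -> v = t /\ v = t').
      { intros h. split; symmetry; [apply endp|apply startq]; simpl; auto. }
      destruct (sepS a (l1 ++ tl l2) b ha hb (rwalk_app _ _ _ _ _ _ w1 w2)) as (w & hw & hl).
      apply in_app_or in hl as [hl|hl].
      - assert (t = w).
        { apply endp; simpl; auto. rewrite ep. apply in_or_app. auto. }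
        subst w. destruct (rwalk_tl_end _ _ _ _ w1') as [<-|h]; [auto|].
        exfalso. rewrite ep in np. exact (NoDup_app_disjoint _ _ _ np hl h).
      - assert (t' = w).
        { apply startq; simpl; auto. rewrite eq. apply in_or_app. auto. }
        subst w. exfalso. rewrite eq in nq.
        exact (NoDup_app_disjoint _ _ _ nq (rwalk_start _ _ _ _ w2') hl). }
    (* Only the walk that ends in x is continued over the edge (x, y). Any other t lies in S and is
       continued by [q t], whose first vertex is dropped because [p t] already contains it. *)
    pose (qq := fun t => if classical_eq_dec t x then q y else tl (q t)).
    pose (sg := fun t => if classical_eq_dec t x then y else t).
    assert (Hsg : forall t, In t (x :: S) -> In (sg t) (y :: S)).
    { intros t ht. unfold sg. destruct (classical_eq_dec t x); simpl; auto.
      destruct ht as [<-|ht]; [congruence|auto]. }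
    assert (Hqq : forall t, incl (qq t) (q (sg t))).
    { intros t. unfold qq, sg. destruct (classical_eq_dec t x); [apply incl_refl|].
      destruct (q t); simpl; [apply incl_refl|apply incl_tl, incl_refl]. }
    assert (cross : forall t t' v, In t (x :: S) -> In t' (x :: S) ->
                In v (p t) -> In v (qq t') -> t = t').
    { intros t t' v ht ht' hv hv'.
      destruct (meet t (sg t') v ht (Hsg t' ht') hv (Hqq t' v hv')) as [-> e].
      unfold sg in e. destruct (classical_eq_dec t' x) as [->|]; [|exact e].
      destruct ht as [ht|ht]; [auto|]. subst t. tauto. }
    rewrite <- lenx. apply (linkage_intro _ _ _ _ (fun t => p t ++ qq t)); auto.
    + intros t ht. destruct (Hp' t ht) as (a & ha & wp & _).
      unfold qq. destruct (classical_eq_dec t x) as [->|ne].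
      * destruct (Hq' y) as (b & hb & wq & _); [simpl; auto|].
        exists a, b. repeat split; auto.
        eapply rwalk_link; [apply mono, wp|left; reflexivity|apply mono, wq].
      * destruct (Hq' t) as (b & hb & wq & _).
        { destruct ht as [ht|ht]; simpl; auto. congruence. }
        exists a, b. repeat split; auto.
        eapply rwalk_app; [apply mono, wp|apply mono, wq].
    + intros t t' v ht ht' h h'. apply in_app_or in h, h'.
      destruct h as [h|h], h' as [h'|h'].
      * exact (dp t t' v ht ht' h h').
      * exact (cross t t' v ht ht' h h').
      * symmetry. exact (cross t' t v ht' ht h' h).
      * assert (e : sg t = sg t').
        { apply (dq _ _ v); auto; apply Hqq; auto. }
        unfold sg in e.
        destruct (classical_eq_dec t x), (classical_eq_dec t' x);
          try congruence; subst.
        -- destruct ht' as [?|?]; [congruence|tauto].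
        -- destruct ht as [?|?]; [congruence|tauto].
Qed.

Lemma separates_mono R R' A B Y : (forall u v, R u v -> R' u v) ->
  separates R' A B Y -> separates R A B Y.
Proof. intros h sep a l b ha hb w. eapply sep; eauto using rwalk_mono. Qed.

(* A separator of E must contain a vertex p of one fixed walk, and the case k - 1
   applies to the graph without p; so finitely many edges suffice. *)
Lemma finite_witness R A B k :
  (forall Y, separates R A B Y -> k <= length Y) ->
  exists E, (forall u v, edge_in E u v -> R u v) /\
    forall Y, separates (edge_in E) A B Y -> k <= length Y.
Proof.
  revert R A. induction k as [|k IH]; intros R A H.
  { exists []. split; [intros u v []|intros; lia]. }
  destruct (classic (separates R A B [])) as [h|h].
  { apply H in h. simpl in h. lia. }
  assert (exists a l b, A a /\ B b /\ rwalk R a l b) as (a & l & b & ha & hb & w).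
  { apply NNPP. intros no. apply h. intros a l b ha hb w. exfalso. apply no.
    exists a, l, b. auto. }
  clear h.
  assert (G : forall l', exists E, (forall u v, edge_in E u v -> R u v) /\
            forall p Y, In p l' -> In p Y -> separates (edge_in E) A B Y -> S k <= length Y).
  { induction l' as [|p l' (E & HE & HY)].
    { exists []. split; [intros u v []|intros p Y []]. }
    destruct (IH (fun u v => R u v /\ u <> p /\ v <> p) (fun v => A v /\ v <> p))
      as (E' & HE' & HY').
    { intros Y sep. enough (S k <= length (p :: Y)) by (simpl in *; lia).
      apply H. intros a' l1 b' ha' hb' w'.
      destruct (classic (In p l1)) as [hp|hp].
      - exists p. simpl. auto.
      - destruct (sep a' l1 b') as (v & hv & hl); auto.
        + split; [auto|]. intros ->. apply hp. exact (rwalk_start _ _ _ _ w').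
        + clear - w' hp. induction w' as [|u v l1 c r w' IHw]; [constructor|].
          simpl in hp. econstructor; [|apply IHw; tauto]. repeat split; auto.
          intros ->. apply hp. right. exact (rwalk_start _ _ _ _ w').
        + exists v. simpl. auto. }
    exists (E' ++ E). split.
    - intros u v h. apply in_app_or in h as [h|h]; [apply HE', h|apply HE, h].
    - intros q Y [<-|hq] hY sep.
      + enough (k <= length (remove classical_eq_dec p Y)).
        { pose proof (remove_length_lt classical_eq_dec Y p hY). lia. }
        apply HY'. intros a' l1 b' [ha' na'] hb' w'.
        destruct (sep a' l1 b' ha' hb') as (v & hv & hl).
        { apply (rwalk_mono _ _ _ _ _ w'). intros u v hu. apply in_or_app. auto. }
        exists v. split; [|exact hl]. apply in_in_remove; [|exact hv].
        intros ->. clear - w' hl na' HE'.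
        induction w' as [u|u c l c' r w' IHw].
        * destruct hl as [hl|[]]. congruence.
        * destruct hl as [hl|hl]; [congruence|]. apply IHw; auto.
          apply (HE' _ _ r).
      + apply (HY q Y); auto. revert sep. apply separates_mono.
        intros u v h. apply in_or_app. auto. }
  destruct (G l) as (E & HE & HY).
  assert (exists E', (forall u v, edge_in E' u v -> R u v) /\ rwalk (edge_in E') a l b)
    as (E' & HE' & w').
  { clear - w. induction w as [a|a b l c r w (E & HE & w')].
    - exists []. split; [intros u v []|constructor].
    - exists ((a, b) :: E). split.
      + intros u v [e|h]; [inversion e; subst; auto|auto].
      + econstructor; [left; reflexivity|].
        apply (rwalk_mono _ _ _ _ _ w'). intros u v h. right. exact h. }
  exists (E' ++ E). split.
  - intros u v h. apply in_app_or in h as [h|h]; auto.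
  - intros Y sep.
    destruct (sep a l b ha hb) as (p & hp & hl).
    { apply (rwalk_mono _ _ _ _ _ w'). intros u v h. apply in_or_app. auto. }
    apply (HY p Y); auto. revert sep. apply separates_mono.
    intros u v h. apply in_or_app. auto.
Qed.

Theorem menger R A B k :
  (forall Y, separates R A B Y -> k <= length Y) -> linkage R A B k.
Proof.
  intros H. destruct (finite_witness R A B k H) as (E & HE & HY).
  destruct (menger_edge_list E A B k HY) as (I & p & nd & len & Hp & disj).
  exists I, p. repeat split; auto. intros i hi.
  destruct (Hp i hi) as (a & b & ha & hb & w & ndp).
  exists a, b. eauto using rwalk_mono.
Qed.

End Menger.

(** * Reachability *)

Section Reach.
Context {V : Type} (adj : V -> V -> Prop).
Implicit Types (P Q : V -> Prop).

Definition reach P (a b : V) :=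
  exists l, rwalk adj a l b /\ forall v, In v l -> P v.

Lemma reach_refl P a : P a -> reach P a a.
Proof. intros h. exists [a]. split; [constructor|]. intros v [<-|[]]. exact h. Qed.

Lemma reach_trans P a b c : reach P a b -> reach P b c -> reach P a c.
Proof.
  intros (l & w & h) (l' & w' & h'). exists (l ++ tl l').
  split; [exact (rwalk_app _ _ _ _ _ _ w w')|].
  intros v hv. apply in_app_or in hv as [hv|hv]; [auto|].
  apply h'. destruct l'; simpl in *; auto.
Qed.

Lemma reach_in_l P a b : reach P a b -> P a.
Proof. intros (l & w & h). exact (h _ (rwalk_start _ _ _ _ w)). Qed.

Lemma reach_in_r P a b : reach P a b -> P b.
Proof. intros (l & w & h). exact (h _ (rwalk_end _ _ _ _ w)). Qed.

Lemma reach_step P a b c : reach P a b -> adj b c -> P c -> reach P a c.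
Proof.
  intros h r pc. apply (reach_trans _ _ _ _ h).
  exists [b; c]. split; [repeat (econstructor; eauto)|].
  intros v [<-|[<-|[]]]; [exact (reach_in_r _ _ _ h)|exact pc].
Qed.

Lemma reach_invariant P Q a b : reach P a b -> Q a ->
  (forall u v, P u -> P v -> adj u v -> Q u -> Q v) -> Q b.
Proof.
  intros (l & w & h) qa closed. induction w as [a|a b l c r w IH]; [exact qa|].
  apply IH; [intros; apply h; simpl; auto|].
  apply (closed a b); auto; apply h; simpl; auto.
  right. exact (rwalk_start _ _ _ _ w).
Qed.

Lemma reach_mono P Q a b : reach P a b -> (forall v, P v -> Q v) -> reach Q a b.
Proof. intros (l & w & h) i. exists l. auto. Qed.

Lemma reach_inter P Q a b : reach P a b -> Q a ->
  (forall u v, P u -> P v -> adj u v -> Q u -> Q v) ->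
  reach (fun v => P v /\ Q v) a b.
Proof.
  intros h qa closed.
  apply (reach_invariant P _ a b h).
  - apply reach_refl. split; [exact (reach_in_l _ _ _ h)|exact qa].
  - intros u v pu pv r hu. apply (reach_step _ _ _ _ hu r).
    split; [exact pv|]. apply (closed u v); auto. apply (reach_in_r _ _ _ hu).
Qed.

Lemma reach_path P a b : reach P a b ->
  exists l, is_path V adj l /\ (forall d, hd d l = a) /\ (forall d, last l d = b) /\
    forall v, In v l -> P v.
Proof.
  intros (l & w & h). destruct (rwalk_NoDup _ _ _ _ w) as (l' & w' & nd & i).
  destruct (rwalk_hd_last _ _ _ _ w') as (ne & wk & hh & hl).
  exists l'. unfold is_path. auto 8.
Qed.

Lemma path_reach P l a b d : is_path V adj l -> hd d l = a -> last l d = b ->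
  (forall v, In v l -> P v) -> reach P a b.
Proof.
  intros (ne & _ & w) <- <- h. destruct l as [|x l]; [congruence|].
  exists (x :: l). split; [|exact h].
  rewrite (last_cons_default x l d x). exact (walk_rwalk _ _ _ w).
Qed.

End Reach.

(** * Tangles *)

Section Graph.
Context {V : Type} {adj : V -> V -> Prop}.
Hypothesis adj_sym : forall u v, adj u v -> adj v u.
Hypothesis G_connected : connected V adj.
Hypothesis G_locally_finite : locally_finite V adj.

Lemma reach_sym P a b : reach adj P a b -> reach adj P b a.
Proof.
  intros (l & w & h). exists (rev l). split; [exact (rwalk_rev _ _ _ _ adj_sym w)|].
  intros v hv. apply h, in_rev, hv.
Qed.

Lemma reach_all a b : reach adj (fun _ => True) a b.
Proof.
  destruct (G_connected a b) as (l & p & h & h').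
  exact (path_reach adj _ _ _ _ _ p h h' (fun _ _ => I)).
Qed.

Lemma finite_neighbourhood (L : list V) :
  exists N, forall v, (exists u, In u L /\ adj u v) -> In v N.
Proof.
  destruct (finite_union L adj) as [N HN]; [intros; apply G_locally_finite|eauto].
Qed.

(** A walk from v to a fixed vertex [v0] either avoids X or has a neighbour of X just before it
    first enters X. So [v0] and the finitely many neighbours of X represent all components. *)
Lemma finitely_many_components (X : list V) :
  exists L, forall v, ~ In v X -> exists r, In r L /\ reach adj (fun w => ~ In w X) r v.
Proof.
  destruct (classic (exists v0 : V, True)) as [[v0 _]|no].
  2:{ exists []. intros v. exfalso. eauto. }
  destruct (finite_neighbourhood X) as [N HN].
  exists (v0 :: N). intros v nv.
  enough (H : reach adj (fun w => ~ In w X) v v0 \/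
            exists r, In r (v0 :: N) /\ reach adj (fun w => ~ In w X) v r).
  { destruct H as [h|(r & hr & h)]; [exists v0|exists r];
      split; simpl; auto using reach_sym. }
  apply (reach_invariant adj _ (fun z => reach adj (fun w => ~ In w X) v z \/
            exists r, In r (v0 :: N) /\ reach adj (fun w => ~ In w X) v r)
            _ _ (reach_all v v0)).
  - left. apply reach_refl, nv.
  - intros u w _ _ r [h|h]; [|right; exact h].
    destruct (classic (In w X)) as [hw|hw].
    + right. exists u. split; [|exact h]. right. apply HN. eauto.
    + left. exact (reach_step _ _ _ _ _ h r hw).
Qed.

Lemma is_sep_sym A B : is_sep V adj A B -> is_sep V adj B A.
Proof.
  intros [h e]. split; [intros v; destruct (h v); auto|].
  intros u v r [hu hv]. exact (e v u (adj_sym _ _ r) (conj hv hu)).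
Qed.

Lemma sep_edge A B u v : is_sep V adj A B -> adj u v -> (A u /\ A v) \/ (B u /\ B v).
Proof.
  intros [h e] r. pose proof (e u v r). pose proof (e v u (adj_sym _ _ r)).
  pose proof (h u). pose proof (h v). tauto.
Qed.

Lemma is_sep_intro (A B : V -> Prop) : (forall v, A v \/ B v) ->
  (forall u v, adj u v -> (A u /\ A v) \/ (B u /\ B v)) -> is_sep V adj A B.
Proof. intros h e. split; [exact h|]. intros u v r. pose proof (e u v r). tauto. Qed.

Lemma has_card_ext (Q Q' : V -> Prop) n :
  (forall v, Q v <-> Q' v) -> has_card V Q n -> has_card V Q' n.
Proof.
  intros e (l & nd & len & h). exists l. split; [exact nd|split; [exact len|]].
  intros v. rewrite <- e. apply h.
Qed.

(** What the argument keeps of a tangle that contains a separation of order n. A pair [(C, D)] in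
    [P] has small side C and points towards D. *)
Definition orients (n : nat) (P : osep V -> Prop) :=
  (forall C D m, is_sep V adj C D -> has_card V (fun v => C v /\ D v) m -> m <= n ->
     P (C, D) \/ P (D, C)) /\
  (forall s1 s2 s3, P s1 -> P s2 -> P s3 -> ~ covers3 V adj (fst s1) (fst s2) (fst s3)).

(** Efficient distinction with the directions fixed: [P] points to B and [Q] points to A. This turns
    the symmetry between the two sides into [efficient_sym]. *)
Definition efficient (n : nat) (A B : V -> Prop) :=
  is_sep V adj A B /\ has_card V (fun v => A v /\ B v) n /\
  exists P Q, orients n P /\ orients n Q /\ P (A, B) /\ Q (B, A) /\
    forall C D m, P (C, D) -> Q (D, C) -> has_card V (fun v => C v /\ D v) m -> n <= m.

Lemma efficient_sym n A B : efficient n A B -> efficient n B A.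
Proof.
  intros (sep & c & P & Q & oP & oQ & pP & pQ & H).
  split; [exact (is_sep_sym _ _ sep)|split].
  - apply (has_card_ext _ _ _ (fun v => and_comm _ _) c).
  - exists Q, P. repeat split; auto; try apply oP; try apply oQ.
    intros C D m hC hD hm. apply (H D C m hD hC).
    apply (has_card_ext _ _ _ (fun v => and_comm _ _) hm).
Qed.

Lemma set_eq_eq (X Y : V -> Prop) : set_eq X Y -> X = Y.
Proof.
  intros h. apply functional_extensionality. intros v.
  apply propositional_extensionality, h.
Qed.

Lemma same_sep_cases (s t : osep V) : same_sep V s t -> s = t \/ s = flip V t.
Proof.
  destruct s as [A B], t as [C D]. unfold same_sep, flip. simpl.
  intros [[h h']|[h h']]; apply set_eq_eq in h, h'; subst; auto.
Qed.

Lemma tangle_orients P s n : tangle V adj P -> P s ->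
  has_card V (fun v => fst s v /\ snd s v) n -> is_sep V adj (fst s) (snd s) /\ orients n P.
Proof.
  intros [[_ (k & H1 & H2 & _)] H3] ps c. destruct (H1 s ps) as [sep (n' & c' & lt)].
  split; [exact sep|split; [|exact H3]].
  assert (n' = n) as -> by (eapply has_card_unique; eauto).
  intros C D m sepC cm le. apply H2; [exact sepC|].
  exists m. split; [exact cm|]. destruct k; [lia|exact I].
Qed.

Lemma eff_distinguishes_efficient P Q s : tangle V adj P -> tangle V adj Q ->
  eff_distinguishes V P Q s -> exists n, efficient n (fst s) (snd s).
Proof.
  assert (K : forall P Q, tangle V adj P -> tangle V adj Q -> P s -> Q (flip V s) ->
    (forall t, distinguishes V P Q t -> ord_le V (fst s) (snd s) (fst t) (snd t)) ->
    exists n, efficient n (fst s) (snd s)).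
  { clear P Q. intros P Q tP tQ ps qs H. destruct s as [A B]. simpl in *.
    pose proof tP as [[_ (k & H1 & _)] H3].
    destruct (H1 _ ps) as [sep (n & c & _)]. simpl in *.
    exists n. split; [exact sep|split; [exact c|]].
    exists P, Q.
    destruct (tangle_orients P (A, B) n tP ps c) as [_ oP].
    destruct (tangle_orients Q (B, A) n tQ qs
               (has_card_ext _ _ _ (fun v => and_comm _ _) c)) as [_ oQ].
    do 4 (split; [assumption|]). intros C D m pC qD cm.
    destruct (H (C, D)) with (n := m) as (n' & c' & le); [|exact cm|].
    - exists (C, D), (D, C). unfold same_sep, set_eq. simpl.
      repeat split; auto; try tauto.
      (* The two orientations could coincide only for C = D; then C is all of V and covers G on its
         own. *)
      intros [h _]. apply set_eq_eq in h. subst D.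
      destruct (tangle_orients P (C, C) m tP pC cm) as [[all _] _]. simpl in all.
      apply (H3 _ _ _ pC pC pC). split; simpl.
      + intros v. destruct (all v); auto.
      + intros u v _. destruct (all u), (all v); auto.
    - simpl in *. rewrite (has_card_unique _ _ _ c c'). exact le. }
  intros tP tQ [(p & q & pp & qq & sp & sq & ne) H].
  apply same_sep_cases in sp, sq.
  destruct sp as [-> | ->], sq as [-> | ->].
  - exfalso. apply ne. unfold set_eq. split; tauto.
  - exact (K P Q tP tQ pp qq H).
  - apply (K Q P tQ tP qq pp). intros t (q & p & hq & hp & sq & sp & ne').
    apply H. exists p, q. repeat split; auto.
    intros [h h']. apply ne'. unfold set_eq in *. split; intros v; symmetry; auto.
  - exfalso. apply ne. unfold set_eq. split; tauto.
Qed.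


Lemma orients_other n P s1 s2 C D m : orients n P -> P s1 -> P s2 ->
  is_sep V adj C D -> has_card V (fun v => C v /\ D v) m -> m <= n ->
  covers3 V adj (fst s1) (fst s2) C -> P (D, C).
Proof.
  intros [o1 o2] p1 p2 sep c le cov.
  destruct (o1 C D m sep c le) as [h|h]; [|exact h].
  exfalso. exact (o2 _ _ _ p1 p2 h cov).
Qed.

Lemma component_closed (X : V -> Prop) r u v :
  adj u v -> reach adj (fun w => ~ X w) r u -> X v \/ reach adj (fun w => ~ X w) r v.
Proof.
  intros e h. destruct (classic (X v)); [auto|].
  right. exact (reach_step _ _ _ _ _ h e H).
Qed.

(* A tangle orienting the separations with separator X points to one component:
   otherwise all components are small, and finitely many small sides unite. *)
Lemma big_component n P (X : V -> Prop) : orients n P -> has_card V X n ->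
  exists r, ~ X r /\
    P (fun v => ~ reach adj (fun w => ~ X w) r v,
       fun v => reach adj (fun w => ~ X w) r v \/ X v).
Proof.
  intros oP c. pose proof c as (lX & _ & _ & HX).
  set (C := fun r v => reach adj (fun w => ~ X w) r v).
  assert (nX : forall r v, C r v -> ~ X v) by (intros r v h; exact (reach_in_r _ _ _ _ h)).
  assert (no_full : forall A D, P (A, D) -> ~ (forall v, A v)).
  { intros A D pA all. apply (proj2 oP _ _ _ pA pA pA). split; simpl; auto. }
  apply NNPP. intros no.
  assert (sepW : forall W : V -> Prop, (forall v, W v -> ~ X v) ->
      (forall u v, adj u v -> W u -> X v \/ W v) ->
      P (fun v => W v \/ X v, fun v => ~ W v) \/ P (fun v => ~ W v, fun v => W v \/ X v)).
  { intros W dis closed. apply (proj1 oP _ _ n); [| |lia].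
    - apply is_sep_intro; [intros v; tauto|]. intros u v e.
      pose proof (closed u v e). pose proof (closed v u (adj_sym _ _ e)). tauto.
    - apply (has_card_ext X); [|exact c]. intros v. pose proof (dis v). tauto. }
  assert (closedC : forall r u v, adj u v -> C r u -> X v \/ C r v).
  { intros r u v. apply component_closed. }
  assert (small : forall r, P (fun v => C r v \/ X v, fun v => ~ C r v)).
  { intros r. destruct (sepW (C r) (nX r) (closedC r)) as [h|h]; [exact h|].
    exfalso. destruct (classic (X r)) as [xr|xr]; [|apply no; exists r; auto].
    apply (no_full _ _ h). intros v hv. apply (reach_in_l _ _ _ _ hv). exact xr. }
  assert (union : forall L, P (fun v => (exists r, In r L /\ C r v) \/ X v,
                             fun v => ~ exists r, In r L /\ C r v)).
  { intros L.
    assert (dis : forall L v, (exists r, In r L /\ C r v) -> ~ X v).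
    { intros L' v (r & _ & h). exact (nX _ _ h). }
    assert (closed : forall L u v, adj u v -> (exists r, In r L /\ C r u) ->
                X v \/ exists r, In r L /\ C r v).
    { intros L' u v e (r & i & h). destruct (closedC _ _ _ e h); eauto. }
    induction L as [|r L IH];
      [destruct (sepW _ (dis []) (closed [])) as [h|h]
      |destruct (sepW _ (dis (r :: L)) (closed (r :: L))) as [h|h]];
      try exact h; exfalso.
    - apply (no_full _ _ h). intros v (r & [] & _).
    (* If the larger union were the big side, its complement, the old union and the new component
       would be three small sides covering G. *)
    - apply (proj2 oP _ _ _ h IH (small r)). split; simpl.
      + intros v. destruct (classic (exists r', In r' L /\ C r' v)); [tauto|].
        destruct (classic (C r v)); [tauto|]. left. intros (r' & [<-|i] & h'); eauto.
      + assert (K : forall u v, adj u v -> (exists r', (r = r' \/ In r' L) /\ C r' u) ->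
            (((exists r', In r' L /\ C r' u) \/ X u) /\ ((exists r', In r' L /\ C r' v) \/ X v)) \/
            ((C r u \/ X u) /\ (C r v \/ X v))).
        { intros u v e (r' & [<-|i] & h'); pose proof (closedC _ _ _ e h') as h''.
          - tauto.
          - left. split; [eauto|]. destruct h''; eauto. }
        intros u v e. pose proof (K u v e). pose proof (K v u (adj_sym _ _ e)). tauto. }
  destruct (finitely_many_components lX) as [L HL].
  apply (no_full _ _ (union L)). intros v.
  destruct (classic (X v)) as [xv|xv]; [auto|]. left.
  destruct (HL v) as (r & hr & h); [now rewrite <- HX|].
  exists r. split; [exact hr|]. apply (reach_mono _ _ _ _ _ h).
  intros w. now rewrite HX.
Qed.

(* The big component of either tangle attaches to the whole separator: its
   neighbourhood also distinguishes the two tangles. *)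
Lemma efficient_tight n A B : efficient n A B ->
  exists r, B r /\ ~ A r /\
    (forall v, reach adj (fun w => ~ (A w /\ B w)) r v -> B v /\ ~ A v) /\
    forall x, A x -> B x ->
      exists y, adj x y /\ reach adj (fun w => ~ (A w /\ B w)) r y.
Proof.
  intros (sep & c & P & Q & oP & oQ & pP & pQ & H).
  destruct (big_component n P _ oP c) as (r & nr & pr).
  set (C := reach adj (fun w => ~ (A w /\ B w)) r) in *.
  assert (closedC : forall u v, adj u v -> C u -> (A v /\ B v) \/ C v).
  { intros u v. apply (component_closed (fun w => A w /\ B w)). }
  assert (side : forall S : V -> Prop, S r -> (forall u v, adj u v -> ~ (A u /\ B u) ->
             ~ (A v /\ B v) -> S u -> S v) -> forall v, C v -> S v).
  { intros S sr cl v h. apply (reach_invariant _ _ _ _ _ h sr).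
    intros u w hu hw e. apply (cl u w e hu hw). }
  assert (edges : forall u v, adj u v -> (A u /\ A v) \/ (B u /\ B v)).
  { intros u v. apply sep_edge, sep. }
  assert (CB : forall v, C v -> B v /\ ~ A v).
  { destruct (classic (A r)) as [ar|ar].
    - exfalso. assert (CA : forall v, C v -> A v).
      { apply side; [exact ar|]. intros u v e hu hv au. pose proof (edges u v e). tauto. }
      (* A big component inside A is impossible: the small side A and the complement of the
         component, also a small side, would cover G. *)
      apply (proj2 oP _ _ _ pP pP pr). split; simpl.
      + intros v. pose proof (CA v). destruct (classic (C v)); auto.
      + intros u v e. pose proof (CA u). pose proof (CA v).
        pose proof (closedC u v e). pose proof (closedC v u (adj_sym _ _ e)). tauto.
    - apply side.
      + destruct sep as [all _]. destruct (all r); tauto.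
      + intros u v e hu hv hs. pose proof (edges u v e). tauto. }
  destruct (CB r (reach_refl _ (fun w => ~ (A w /\ B w)) _ nr)) as [br ar].
  exists r. do 3 (split; [assumption|]). intros x ax bx. apply NNPP. intros no.
  (* The attachment set of the component. As it misses x, the separation of C + N from the
     complement of C has order below n. [P] points to C by the choice of C, while [Q] points away
     from it because C + N lies in B, a small side of [Q]. *)
  set (N := fun v => (A v /\ B v) /\ exists y, adj v y /\ C y).
  destruct c as (lX & nd & len & HX).
  destruct (finite_card N (remove classical_eq_dec x lX)) as (m & cm & le).
  { intros v [hv hy]. apply in_in_remove; [|now apply HX].
    intros ->. apply no. destruct hy as (y & e & h). eauto. }
  assert (lt : m < n).
  { pose proof (remove_length_lt classical_eq_dec lX x (proj1 (HX x) (conj ax bx))). lia. }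
  assert (closedN : forall u v, adj u v -> C u -> C v \/ N v).
  { intros u v e h. destruct (closedC u v e h); [|auto].
    right. split; [auto|]. exists u. auto. }
  assert (nX : forall v, C v -> ~ (A v /\ B v)) by (intros v h; apply CB in h; tauto).
  assert (sepN : is_sep V adj (fun v => C v \/ N v) (fun v => ~ C v)).
  { apply is_sep_intro; [intros v; tauto|]. intros u v e.
    pose proof (closedN u v e). pose proof (closedN v u (adj_sym _ _ e)). tauto. }
  assert (cN : has_card V (fun v => (C v \/ N v) /\ ~ C v) m).
  { apply (has_card_ext N); [|exact cm]. intros v. pose proof (nX v). unfold N. tauto. }
  assert (cN' : has_card V (fun v => ~ C v /\ (C v \/ N v)) m).
  { revert cN. apply has_card_ext. intros v. tauto. }
  enough (n <= m) by lia.
  apply (H (fun v => ~ C v) (fun v => C v \/ N v) m); [| |exact cN'].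
  - apply (orients_other n P _ _ _ _ m oP pr pr sepN cN); [lia|]. split; simpl.
    + intros v. tauto.
    + intros u v e. pose proof (closedN u v e). pose proof (closedN v u (adj_sym _ _ e)). tauto.
  - apply (orients_other n Q _ _ _ _ m oQ pQ pQ (is_sep_sym _ _ sepN) cN'); [lia|].
    split; simpl.
    + intros v. pose proof (CB v). tauto.
    + intros u v e. pose proof (CB u). pose proof (CB v).
      pose proof (closedC u v e). pose proof (closedC v u (adj_sym _ _ e)). tauto.
Qed.

(* Submodularity: the corner (A + E, B & F) would distinguish the two tangles
   with a smaller order. *)
Lemma corner_bound n A B E F m (P Q : osep V -> Prop) (l : list V) :
  is_sep V adj A B -> has_card V (fun v => A v /\ B v) n ->
  orients n P -> orients n Q -> P (A, B) -> Q (B, A) ->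
  (forall C D k, P (C, D) -> Q (D, C) -> has_card V (fun v => C v /\ D v) k -> n <= k) ->
  is_sep V adj E F -> has_card V (fun v => E v /\ F v) m -> P (E, F) ->
  NoDup l -> (forall v, In v l -> A v /\ B v /\ E v /\ ~ F v) -> length l <= m.
Proof.
  intros sep (lX & ndX & lenX & HX) oP oQ pP pQ H sepE (lS & ndS & lenS & HS) pE nd Hl.
  destruct (le_lt_dec (length l) m) as [le|lt]; [exact le|exfalso].
  set (rest := filter (fun v => if in_dec classical_eq_dec v l then false else true) lX).
  assert (Hrest : forall v, In v rest <-> In v lX /\ ~ In v l).
  { intros v. unfold rest. rewrite filter_In.
    destruct (in_dec classical_eq_dec v l); intuition discriminate. }
  assert (lenR : length rest + length l <= n).
  { rewrite <- lenX, <- length_app. apply NoDup_incl_length.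
    - apply NoDup_app; [apply NoDup_filter, ndX|exact nd|].
      intros v hv. apply Hrest, hv.
    - intros v hv. apply in_app_or in hv as [hv|hv]; [apply Hrest, hv|].
      apply HX. destruct (Hl v hv). tauto. }
  (* A vertex of the corner separator lies in E & F or in A & B & F, and the latter set misses [l].
     So the corner has order at most n - |l| + m, which is below n if |l| > m. *)
  destruct (finite_card (fun v => (A v \/ E v) /\ (B v /\ F v)) (rest ++ lS)) as (k & ck & le).
  { intros v [[a|e] [b f]]; apply in_or_app; [left|right; apply HS; auto].
    apply Hrest. split; [apply HX; auto|]. intros h. apply Hl in h. tauto. }
  rewrite length_app in le.
  assert (edges : forall u v, adj u v -> (A u /\ A v) \/ (B u /\ B v)).
  { intros u v. apply sep_edge, sep. }
  assert (edges' : forall u v, adj u v -> (E u /\ E v) \/ (F u /\ F v)).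
  { intros u v. apply sep_edge, sepE. }
  destruct sep as [all _], sepE as [all' _].
  assert (sepC : is_sep V adj (fun v => A v \/ E v) (fun v => B v /\ F v)).
  { apply is_sep_intro.
    - intros v. destruct (all v), (all' v); auto.
    - intros u v e. pose proof (edges u v e). pose proof (edges' u v e). tauto. }
  assert (ck' : has_card V (fun v => (B v /\ F v) /\ (A v \/ E v)) k).
  { revert ck. apply has_card_ext. intros v. tauto. }
  enough (n <= k) by lia.
  apply (H (fun v => A v \/ E v) (fun v => B v /\ F v) k); [| |exact ck].
  - apply (orients_other n P _ _ _ _ k oP pP pE (is_sep_sym _ _ sepC) ck'); [lia|].
    split; simpl.
    + intros v. destruct (all v), (all' v); auto.
    + intros u v e. pose proof (edges u v e). pose proof (edges' u v e). tauto.
  - apply (orients_other n Q _ _ _ _ k oQ pQ pQ sepC ck); [lia|].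
    split; simpl.
    + intros v. destruct (all v); auto.
    + intros u v e. pose proof (edges u v e). tauto.
Qed.

(** If m < n, then [P] orients {E, F}, and [corner_bound] applies to the small side. If n <= m,
    already A & B has at most m vertices. *)
Lemma efficient_unsplit n A B E F m l l' : efficient n A B ->
  is_sep V adj E F -> has_card V (fun v => E v /\ F v) m ->
  NoDup l -> (forall v, In v l -> A v /\ B v /\ E v /\ ~ F v) ->
  NoDup l' -> (forall v, In v l' -> A v /\ B v /\ F v /\ ~ E v) ->
  length l <= m \/ length l' <= m.
Proof.
  intros (sep & c & P & Q & oP & oQ & pP & pQ & H) sepE cE nd Hl nd' Hl'.
  destruct (le_lt_dec n m) as [le|lt].
  { left. transitivity n; [|exact le]. destruct c as (lX & _ & <- & HX).
    apply NoDup_incl_length; [exact nd|]. intros v hv. apply HX.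
    destruct (Hl v hv). tauto. }
  assert (cF : has_card V (fun v => F v /\ E v) m).
  { revert cE. apply has_card_ext. intros v. tauto. }
  assert (oE : P (E, F) \/ P (F, E)) by (apply (proj1 oP _ _ m); auto; lia).
  destruct oE as [pE|pE]; [left|right].
  - exact (corner_bound _ _ _ _ _ _ _ _ _ sep c oP oQ pP pQ H sepE cE pE nd Hl).
  - exact (corner_bound _ _ _ _ _ _ _ _ _ sep c oP oQ pP pQ H
             (is_sep_sym _ _ sepE) cF pE nd' Hl').
Qed.

(** * Limits of chains of efficient separations *)

Section Chain.
Variable s : nat -> osep V.
Hypothesis s_increasing : forall i, olt (s i) (s (S i)).
Hypothesis s_efficient : forall i, exists n, efficient n (fst (s i)) (snd (s i)).
Hypothesis B_nonempty : exists v, snd (lim_sep s) v.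

Local Notation A := (fst (lim_sep s)).
Local Notation B := (snd (lim_sep s)).

Definition limit_separator : V -> Prop := fun v => A v /\ B v.

Lemma chain_le i j : i <= j -> ole V (s i) (s j).
Proof.
  induction 1 as [|j _ [h h']]; [split; auto|].
  destruct (s_increasing j) as [[k k'] _]. split; auto.
Qed.

Lemma chain_sep i : is_sep V adj (fst (s i)) (snd (s i)).
Proof. destruct (s_efficient i) as [n [h _]]. exact h. Qed.

(** This transfers finite statements to the limit: vertices of A & B lie in every B_j anyway, so
    finitely many of them belong to all separators of the chain from some index on. *)
Lemma eventually_in_A (l : list V) :
  exists i, forall j, i <= j -> forall v, In v l -> A v -> fst (s j) v.
Proof.
  induction l as [|v l [i Hi]].
  - exists 0. intros j _ v [].
  - destruct (classic (A v)) as [[k hk]|nv].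
    + exists (max i k). intros j hj w [<-|hw] aw.
      * apply (chain_le k j ltac:(lia)), hk.
      * apply (Hi j ltac:(lia) w hw aw).
    + exists i. intros j hj w [<-|hw] aw; [tauto|]. exact (Hi j hj w hw aw).
Qed.

Lemma lim_is_sep : is_sep V adj A B.
Proof.
  split.
  - intros v. destruct (classic (A v)) as [h|h]; [auto|right].
    intros i. destruct (chain_sep i) as [all _].
    destruct (all v) as [a|b]; [|exact b]. exfalso. apply h. exists i. exact a.
  - intros u v e [[[i au] nbu] [bv nav]].
    apply not_all_ex_not in nbu as [j nbu].
    destruct (chain_sep (max i j)) as [_ no]. apply (no u v e).
    split; split.
    + apply (chain_le i (max i j) ltac:(lia)), au.
    + intros h. apply nbu. apply (chain_le j (max i j) ltac:(lia)), h.
    + apply bv.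
    + intros h. apply nav. exists (max i j). exact h.
Qed.

Lemma limit_separator_nonempty : exists u, limit_separator u.
Proof.
  apply NNPP. intros no.
  destruct (s_efficient 0) as [n eff].
  (* A is nonempty because A_0 contains a tight component. If A & B were empty, no edge could leave
     A, and connectedness would put b into A. *)
  destruct (efficient_tight _ _ _ (efficient_sym _ _ _ eff)) as (a & ha & _).
  destruct B_nonempty as [b hb].
  apply no. exists b. split; [|exact hb].
  apply (reach_invariant adj _ _ _ _ (reach_all a b)).
  - exists 0. exact ha.
  - intros u v _ _ e au.
    destruct (sep_edge _ _ _ _ lim_is_sep e) as [h|h]; [apply h|].
    exfalso. apply no. exists u. split; [exact au|apply h].
Qed.

Lemma limit_separator_infinite : ~ finite_set V limit_separator.
Proof.
  intros [l Hl].
  destruct (finite_neighbourhood l) as [N HN].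
  (* From [i0] on, A_i contains all of U and also every neighbour of U that lies in A. *)
  destruct (eventually_in_A (l ++ N)) as [i0 Hi0].
  destruct limit_separator_nonempty as [u0 hu0].
  assert (edge : forall u v, adj u v -> (A u /\ A v) \/ (B u /\ B v)).
  { intros u v. apply sep_edge, lim_is_sep. }
  assert (U_in : forall i v, i0 <= i -> limit_separator v -> fst (s i) v /\ snd (s i) v).
  { intros i v hi hv. split; [|apply hv].
    apply (Hi0 i hi v); [apply in_or_app; left; auto|apply hv]. }
  assert (nbr_in : forall i u v, i0 <= i -> limit_separator u -> adj u v -> A v -> fst (s i) v).
  { intros i u v hi hu e. apply (Hi0 i hi v).
    apply in_or_app. right. apply HN. exists u. auto. }
  (* The tight component on the side of B_i has a neighbour y of u0. Since y is outside A_i, the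
     choice of [i0] puts it outside A. The component avoids the i-th separator, which contains U, so
     it never crosses into A. Every x in that separator thus has a neighbour outside A, and so lies
     in B. *)
  assert (X_eq : forall i x, i0 <= i -> fst (s i) x -> snd (s i) x -> limit_separator x).
  { intros i x hi ax bx. destruct (s_efficient i) as [n eff].
    destruct (efficient_tight _ _ _ eff) as (r & _ & _ & HC & nb).
    destruct (U_in i u0 hi hu0) as [au bu].
    destruct (nb u0 au bu) as (y & ey & ry).
    assert (ny : ~ A y).
    { intros h. apply (HC y ry). exact (nbr_in i u0 y hi hu0 ey h). }
    destruct (nb x ax bx) as (z & ez & rz).
    assert (nz : ~ A z).
    { apply (reach_invariant adj _ (fun z => ~ A z) _ _
               (reach_trans _ _ _ _ _ (reach_sym _ _ _ ry) rz) ny).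
      intros u v hu hv e nu av. destruct (edge u v e) as [h|h]; [tauto|].
      apply hv, U_in; [exact hi|split; [exact av|apply h]]. }
    split; [exists i; exact ax|].
    destruct (edge x z ez) as [h|h]; [tauto|apply h]. }
  (* Both separators are now equal to U. An edge leaving the difference of the two sets A_i would
     have an end in U and make its other end a neighbour of U in A, contrary to the choice of [i0].
     By connectedness a nonempty difference would contain u0. *)
  assert (A_eq : forall v, fst (s (S i0)) v -> fst (s i0) v).
  { intros v hv. apply NNPP. intros nv.
    enough (h : fst (s (S i0)) u0 /\ ~ fst (s i0) u0).
    { apply h, U_in; auto. }
    apply (reach_invariant adj _ (fun v => fst (s (S i0)) v /\ ~ fst (s i0) v) _ _
             (reach_all v u0)); [auto|].
    intros u w _ _ e [au nu].
    assert (nbu : ~ snd (s (S i0)) u).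
    { intros h. apply nu, U_in; [lia|]. apply (X_eq (S i0)); auto. }
    split.
    - destruct (sep_edge _ _ _ _ (chain_sep (S i0)) e) as [h|h]; [apply h|tauto].
    - intros aw. apply nu.
      apply (nbr_in i0 w u); auto.
      + apply (X_eq i0); auto.
        destruct (sep_edge _ _ _ _ (chain_sep i0) e) as [h|h]; [tauto|apply h].
      + exists (S i0). exact au. }
  destruct (s_increasing i0) as [[le le'] ne]. apply ne.
  split; intros v; split; auto.
  intros bv. destruct (chain_sep (S i0)) as [all _].
  destruct (all v) as [av|h]; [|exact h].
  apply (X_eq i0 v); auto.
Qed.

Lemma limit_separator_unsplit E F m l l' :
  is_sep V adj E F -> has_card V (fun v => E v /\ F v) m ->
  NoDup l -> (forall v, In v l -> limit_separator v /\ E v /\ ~ F v) ->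
  NoDup l' -> (forall v, In v l' -> limit_separator v /\ F v /\ ~ E v) ->
  length l <= m \/ length l' <= m.
Proof.
  intros sepE c nd Hl nd' Hl'.
  destruct (eventually_in_A (l ++ l')) as [i Hi].
  destruct (s_efficient i) as [n eff].
  apply (efficient_unsplit n _ _ E F m l l' eff); auto; intros v hv;
    [destruct (Hl v hv) as [[a b] h]|destruct (Hl' v hv) as [[a b] h]];
    (split; [apply (Hi i (le_n i) v); [apply in_or_app; auto|exact a]|split; [apply b|exact h]]).
Qed.

End Chain.

(** * The end defined by an unsplittable set *)

Section Direction.
Variable U : V -> Prop.
Hypothesis U_infinite : ~ finite_set V U.
Hypothesis U_unsplit : forall E F m l l',
  is_sep V adj E F -> has_card V (fun v => E v /\ F v) m ->
  NoDup l -> (forall v, In v l -> U v /\ E v /\ ~ F v) ->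
  NoDup l' -> (forall v, In v l' -> U v /\ F v /\ ~ E v) ->
  length l <= m \/ length l' <= m.

Local Notation avoiding S := (fun w => ~ In w S).

(* The component of G - S that contains all but finitely many vertices of U. *)
Definition direction (S : list V) (v : V) :=
  ~ In v S /\ ~ finite_set V (fun u => U u /\ reach adj (avoiding S) v u).

Lemma direction_reach S v w :
  direction S v -> reach adj (avoiding S) v w -> direction S w.
Proof.
  intros [nv inf] h. split; [exact (reach_in_r _ _ _ _ h)|].
  intros fin. apply inf. apply (finite_subset _ _ fin).
  intros u [hu r]. split; [exact hu|].
  exact (reach_trans _ _ _ _ _ (reach_sym _ _ _ h) r).
Qed.

Lemma direction_adj S v w : direction S v -> adj v w -> ~ In w S -> direction S w.
Proof.
  intros h e nw. apply (direction_reach S v w h).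
  apply (reach_step _ _ _ v); auto. apply reach_refl, h.
Qed.

Lemma direction_nonempty S : exists v, direction S v.
Proof.
  apply NNPP. intros no. apply U_infinite.
  destruct (finitely_many_components S) as [L HL].
  destruct (finite_union L (fun r u => U u /\ reach adj (avoiding S) r u)) as [l Hl].
  { intros r _. apply NNPP. intros inf. apply no. exists r. split; [|exact inf].
    intros hr. apply inf. exists []. intros u [_ h]. apply (reach_in_l _ _ _ _ h), hr. }
  exists (S ++ l). intros u hu. apply in_or_app.
  destruct (classic (In u S)) as [h|h]; [auto|right].
  apply Hl. destruct (HL u h) as (r & hr & hru). exists r. auto.
Qed.

(** Two such components would be separated by S with infinitely many vertices of U on either side; m
    + 1 on each contradict [U_unsplit]. *)
Lemma direction_connected S v w :
  direction S v -> direction S w -> reach adj (avoiding S) v w.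
Proof.
  intros [nv iv] [nw iw]. apply NNPP. intros no.
  set (C := reach adj (avoiding S) v) in *.
  assert (closed : forall a b, adj a b -> C a -> In b S \/ C b).
  { intros a b. apply (component_closed (fun w => In w S)). }
  assert (sep : is_sep V adj (fun x => C x \/ In x S) (fun x => ~ C x)).
  { apply is_sep_intro; [intros x; tauto|]. intros a b e.
    pose proof (closed a b e). pose proof (closed b a (adj_sym _ _ e)). tauto. }
  destruct (finite_card (fun x => (C x \/ In x S) /\ ~ C x) S) as (m & c & _); [tauto|].
  destruct (infinite_many _ (1 + m) iv) as (l & nd & len & Hl).
  destruct (infinite_many _ (1 + m) iw) as (l' & nd' & len' & Hl').
  destruct (U_unsplit _ _ m l l' sep c nd) as [h|h]; auto; try lia.
  - intros x hx. destruct (Hl x hx) as [ux cx]. tauto.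
  - intros x hx. destruct (Hl' x hx) as [ux cx].
    assert (nx : ~ C x).
    { intros h. apply no. exact (reach_trans _ _ _ _ _ h (reach_sym _ _ _ cx)). }
    pose proof (reach_in_r _ _ _ _ cx). simpl in *. tauto.
Qed.

Lemma direction_reach_inside S v w :
  direction S v -> reach adj (avoiding S) v w -> reach adj (direction S) v w.
Proof.
  intros hv h.
  apply (reach_mono adj (fun x => ~ In x S /\ direction S x)); [|tauto].
  apply reach_inter; auto. intros a b _ nb e ha. exact (direction_adj S a b ha e nb).
Qed.

(** A component of G - S' that misses S stays connected in G - S. S need not be a subset of S': it
    is enough that S' cuts S off from the end. *)
Lemma direction_antitone S S' v :
  (forall x, In x S -> ~ direction S' x) -> direction S' v -> direction S v.
Proof.
  intros dis hv. split; [intros h; exact (dis v h hv)|].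
  intros fin. apply (proj2 hv). apply (finite_subset _ _ fin).
  intros u [hu r]. split; [exact hu|].
  apply (reach_mono _ _ _ _ _ (direction_reach_inside S' v u hv r)).
  intros x hx h. exact (dis x h hx).
Qed.

(** At most |S| elements of T lie in S itself. The others lie across S from infinitely many vertices
    of U, so [U_unsplit] allows at most |S| of them as well. *)
Lemma direction_count S T : NoDup T -> (forall t, In t T -> U t /\ ~ direction S t) ->
  length T <= 2 * length S.
Proof.
  intros nd HT.
  set (T1 := filter (fun v => if in_dec classical_eq_dec v S then false else true) T).
  assert (HT1 : forall v, In v T1 <-> In v T /\ ~ In v S).
  { intros v. unfold T1. rewrite filter_In.
    destruct (in_dec classical_eq_dec v S); intuition discriminate. }
  assert (sep : is_sep V adj (fun x => ~ direction S x) (fun x => direction S x \/ In x S)).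
  { apply is_sep_intro; [intros x; tauto|]. intros a b e.
    pose proof (fun h => direction_adj S a b h e).
    pose proof (fun h => direction_adj S b a h (adj_sym _ _ e)). tauto. }
  destruct (finite_card (fun x => ~ direction S x /\ (direction S x \/ In x S)) S)
    as (m & c & le); [tauto|].
  destruct (direction_nonempty S) as [v hv].
  destruct (infinite_many _ (1 + m) (proj2 hv)) as (l' & nd' & len' & Hl').
  assert (len1 : length T1 <= m).
  { destruct (U_unsplit _ _ m T1 l' sep c) as [h|h]; auto; try lia.
    - apply NoDup_filter, nd.
    - intros x hx. apply HT1 in hx as [hx nx]. destruct (HT x hx). tauto.
    - intros x hx. destruct (Hl' x hx) as [ux r].
      pose proof (direction_reach S v x hv r). tauto. }
  enough (length T <= length (T1 ++ S)) by (rewrite length_app in *; lia).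
  apply NoDup_incl_length; [exact nd|]. intros t ht. apply in_or_app.
  destruct (classic (In t S)); [auto|left]. apply HT1. auto.
Qed.

(** For rays this is membership in the end determined by U. *)
Definition converges (R : nat -> V) :=
  forall S, exists m, forall j, m <= j -> direction S (R j).

Lemma ray_avoids R S : is_ray V adj R -> exists m, forall j, m <= j -> ~ In (R j) S.
Proof.
  intros [inj _]. induction S as [|v S [m Hm]].
  - exists 0. intros j _ [].
  - destruct (classic (exists i, R i = v)) as [[i <-]|no].
    + exists (max m (i + 1)). intros j hj [h|h].
      * apply inj in h. lia.
      * apply (Hm j); auto. lia.
    + exists m. intros j hj [h|h]; [eauto|]. exact (Hm j hj h).
Qed.

Lemma ray_reach R S m j : is_ray V adj R -> (forall i, m <= i -> ~ In (R i) S) ->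
  m <= j -> reach adj (avoiding S) (R m) (R j).
Proof.
  intros [_ e] av. induction 1 as [|j le IH].
  - apply reach_refl, av. auto.
  - apply (reach_step _ _ _ _ _ IH (e j)), av. lia.
Qed.

Lemma ray_equiv_sym R R' : ray_equiv V adj R R' -> ray_equiv V adj R' R.
Proof.
  intros H X fin. destruct (H X fin) as (m & n & l & h & h' & p & hh & hl & av).
  exists n, m.
  destruct (reach_path adj _ _ _ (reach_sym _ _ _ (path_reach adj _ _ _ _ _ p hh hl av)))
    as (l' & p' & hh' & hl' & av').
  exists l'. auto 8.
Qed.

Lemma converges_equiv R R' : converges R -> converges R' -> ray_equiv V adj R R'.
Proof.
  intros c c' X [S HS].
  destruct (c S) as [m Hm], (c' S) as [n Hn].
  exists m, n.
  destruct (reach_path adj _ _ _ (direction_connected S (R m) (R' n) (Hm m (le_n m)) (Hn n (le_n n))))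
    as (l & p & hh & hl & av).
  exists l. repeat split; auto; try apply p.
  - intros j hj h. apply (proj1 (Hm j hj)), HS, h.
  - intros j hj h. apply (proj1 (Hn j hj)), HS, h.
  - intros v hv h. apply (av v hv), HS, h.
Qed.

Lemma equiv_converges R R' : is_ray V adj R -> is_ray V adj R' ->
  converges R -> ray_equiv V adj R R' -> converges R'.
Proof.
  intros r r' c H S.
  destruct (H (fun v => In v S)) as (m & n & l & h & h' & p & hh & hl & av).
  { exists S. auto. }
  exists n. intros j hj. destruct (c S) as [k Hk].
  apply (direction_reach S (R (max m k))); [apply Hk; lia|].
  apply (reach_trans _ _ _ (R m)).
  { apply reach_sym, ray_reach; auto. lia. }
  apply (reach_trans _ _ _ (R' n)); [exact (path_reach adj _ _ _ _ _ p hh hl av)|].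
  apply ray_reach; auto.
Qed.

Lemma disjoint_lists_escape (p : nat -> list V) (K : list V) :
  (forall i j v, i <> j -> In v (p i) -> ~ In v (p j)) ->
  exists i, forall v, In v K -> ~ In v (p i).
Proof.
  intros dis. apply NNPP. intros no.
  assert (H : forall i, exists v, In v K /\ In v (p i)).
  { intros i. apply NNPP. intros h. apply no. exists i. intros v hv hp.
    apply h. eauto. }
  destruct (H 0) as (v0 & _ & _).
  destruct (choice_on (fun _ => True) _ v0 (fun i _ => H i)) as [f Hf].
  assert (nd : NoDup (map f (seq 0 (1 + length K)))).
  { apply NoDup_map_NoDup_ForallPairs; [|apply seq_NoDup].
    intros i j _ _ e. apply NNPP. intros ne.
    apply (dis i j (f i) ne); [apply Hf; exact I|]. rewrite e. apply Hf. exact I. }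
  apply NoDup_incl_length with (l' := K) in nd.
  - rewrite length_map, length_seq in nd. lia.
  - intros v hv. apply in_map_iff in hv as (i & <- & _). apply Hf. exact I.
Qed.

Lemma comb_converges R P : is_comb V adj R P U -> converges R.
Proof.
  intros (r & path & start & _ & dis & teeth) S.
  destruct (ray_avoids R S r) as [m Hm]. exists m. intros j hj.
  apply (direction_reach S (R m)); [|apply ray_reach; auto].
  split; [apply Hm; auto|]. intros [L HL].
  (* If the component of the tail had only finitely many vertices of U, listed in [L], some comb
     path would avoid S, the start of the ray and [L]. It would join the tail to a tooth outside [L]
     within that component. *)
  destruct (disjoint_lists_escape P (S ++ map R (seq 0 m) ++ L) dis) as [i Hi].
  destruct (start i) as [k hk].
  pose proof (path i) as pi. destruct (P i) as [|x l] eqn:E; [destruct pi; congruence|].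
  simpl in hk. subst x.
  assert (last_in : In (last (R k :: l) (R 0)) (R k :: l)).
  { clear. generalize (R k). induction l as [|y l IH]; intros x; [simpl; auto|].
    right. exact (IH y). }
  assert (km : m <= k).
  { destruct (le_lt_dec m k) as [h|h]; [exact h|]. exfalso.
    apply (Hi (R k)); [|simpl; auto]. apply in_or_app. right. apply in_or_app. left.
    apply in_map, in_seq. lia. }
  apply (Hi (last (R k :: l) (R 0))); [|exact last_in].
  apply in_or_app. right. apply in_or_app. right. apply HL.
  split; [specialize (teeth i); now rewrite E in teeth|].
  apply (reach_trans _ _ _ (R k)); [apply ray_reach; auto|].
  apply (path_reach adj _ (R k :: l) _ _ (R 0) pi); auto.
  intros v hv h. apply (Hi v); auto. apply in_or_app. auto.
Qed.

Lemma converges_comb R : is_ray V adj R -> converges R -> exists P, is_comb V adj R P U.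
Proof.
  intros r c.
  assert (H : forall Y : list V, exists p, is_path V adj p /\ on_ray V R (hd (R 0) p) /\
     (forall v, In v (tl p) -> ~ on_ray V R v) /\ U (last p (R 0)) /\
     forall v, In v p -> ~ In v Y).
  { intros Y. destruct (c Y) as [m Hm].
    destruct (infinite_many _ 1 (proj2 (Hm m (le_n m)))) as ([|u l] & _ & len & Hl);
      [discriminate|].
    destruct (Hl u) as [hu (w & hw & av)]; [simpl; auto|].
    (* Leaving the ray for the last time keeps the rest of the path off it. If u itself is on the
       ray, the path is the single vertex u. *)
    destruct (rwalk_last _ (on_ray V R) _ _ _ hw) as (x & l1 & hx & w1 & i1).
    { exists (R m). split; [exact (rwalk_start _ _ _ _ hw)|exists m; reflexivity]. }
    destruct (rwalk_NoDup _ _ _ _ w1) as (l2 & w2 & nd & i2).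
    assert (w3 : rwalk adj x l2 u) by (apply (rwalk_mono _ _ _ _ _ w2); tauto).
    destruct (rwalk_hd_last _ _ _ _ w3) as (ne & wk & hh & hl).
    exists l2. rewrite hh, hl. repeat split; auto.
    clear - w2. induction w2 as [a|a b l c e w IH]; intros v hv; [destruct hv|].
    simpl in hv. destruct (rwalk_cases _ _ _ _ w) as [l' ->].
    destruct hv as [<-|hv]; [apply e|exact (IH v hv)]. }
  destruct (choice_on (fun _ => True) _ [] (fun Y _ => H Y)) as [f Hf].
  set (acc := fix acc n := match n with 0 => [] | S k => f (acc k) ++ acc k end).
  assert (acc_in : forall i j v, i < j -> In v (f (acc i)) -> In v (acc j)).
  { intros i j v lt hv. induction lt as [|j lt IH]; simpl; apply in_or_app; auto. }
  exists (fun n => f (acc n)). split; [exact r|].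
  do 3 (split; [intros i; apply (Hf (acc i) I)|]). split.
  - intros i j v ne hi hj. destruct (Nat.lt_gt_cases i j) as [K _].
    destruct (K ne) as [lt|lt].
    + apply (Hf (acc j) I) in hj. apply hj. exact (acc_in i j v lt hi).
    + apply (Hf (acc i) I) in hi. apply hi. exact (acc_in j i v lt hj).
  - intros i. apply (Hf (acc i) I).
Qed.

Lemma end_in_closure om : is_end V adj om -> in_closure V adj om U ->
  forall R, om R <-> is_ray V adj R /\ converges R.
Proof.
  intros (R0 & r0 & H) (R1 & P & h1 & comb) R.
  apply H in h1 as [r1 e1]. pose proof (comb_converges _ _ comb) as c1.
  assert (c0 : converges R0) by (apply (equiv_converges R1); auto using ray_equiv_sym).
  rewrite H. split; intros [r h]; split; auto.
  - exact (equiv_converges _ _ r0 r c0 h).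
  - exact (converges_equiv _ _ c0 h).
Qed.

(** * Disjoint rays *)

(** A minimum-size separator of Z from the end. It may contain vertices of Z, so Z itself is a
    candidate. *)
Definition cuts_off (Z S : list V) :=
  (forall z, In z Z -> ~ direction S z) /\
  forall S', (forall z, In z Z -> ~ direction S' z) -> length S <= length S'.

Lemma cuts_off_exists Z : exists S, cuts_off Z S.
Proof.
  assert (H : forall n S, length S <= n -> (forall z, In z Z -> ~ direction S z) ->
            exists S', cuts_off Z S').
  { induction n as [|n IH]; intros S le av.
    - exists S. split; [exact av|]. intros; lia.
    - destruct (classic (exists S', (forall z, In z Z -> ~ direction S' z) /\
                           length S' < length S)) as [(S' & av' & lt)|no].
      + apply (IH S'); [lia|exact av'].
      + exists S. split; [exact av|]. intros S' av'.
        destruct (le_lt_dec (length S) (length S')); [assumption|exfalso; eauto]. }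
  apply (H (length Z) Z (le_n _)). intros z hz [nz _]. auto.
Qed.

Lemma cuts_off_NoDup Z S : cuts_off Z S -> NoDup S.
Proof.
  intros [av min]. apply (@NoDup_incl_NoDup V (nodup classical_eq_dec S)).
  - apply NoDup_nodup.
  - apply min. intros z hz h. apply (av z hz). revert h. apply direction_antitone.
    intros x hx [nx _]. apply nx, nodup_In, hx.
  - intros v. apply nodup_In.
Qed.

(** Otherwise x could be dropped from S: returning it to the graph would not enlarge the component
    in which the end lies. *)
Lemma cuts_off_adj Z S x : cuts_off Z S -> In x S -> exists y, direction S y /\ adj x y.
Proof.
  intros [av min] hx. apply NNPP. intros no.
  enough (length S <= length (remove classical_eq_dec x S)).
  { pose proof (remove_length_lt classical_eq_dec S x hx). lia. }
  apply min. intros z hz dz. apply (av z hz).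
  destruct (direction_nonempty S) as [w hw].
  assert (hw' : direction (remove classical_eq_dec x S) w).
  { apply (direction_antitone _ S); [|exact hw].
    intros y hy [ny _]. apply ny. apply in_remove in hy. tauto. }
  apply (reach_invariant adj _ _ _ _ (direction_connected _ _ _ hw' dz) hw).
  intros a b _ nb e ha. apply (direction_adj S a b ha e). intros hb.
  apply nb. apply in_in_remove; [|exact hb]. intros ->. eauto.
Qed.

Lemma levels_exist : exists Z T : nat -> list V,
  (forall n, cuts_off (Z n) (T n)) /\
  (forall n, incl (Z n) (Z (S n))) /\
  (forall n, incl (T n) (Z (S n))) /\
  (forall n u v, In u (Z n) \/ In u (T n) -> adj u v -> In v (Z (S n))) /\
  (forall n, length (T n) < length (T (S n))) /\
  forall v, exists n, In v (Z n).
Proof.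
  assert (H : forall c : list V * list V, True -> exists c' : list V * list V,
    cuts_off (fst c') (snd c') /\ incl (fst c) (fst c') /\ incl (snd c) (fst c') /\
    (forall u v, In u (fst c) \/ In u (snd c) -> adj u v -> In v (fst c')) /\
    length (snd c) < length (snd c')).
  { intros [Z T] _. simpl.
    destruct (finite_neighbourhood (Z ++ T)) as [N HN].
    (* By [direction_count], a set that cuts off 1 + 2|T| vertices of U has more than |T|
       elements. *)
    destruct (infinite_many U (1 + 2 * length T) U_infinite) as (L & nd & len & HL).
    destruct (cuts_off_exists (Z ++ T ++ N ++ L)) as [T' cut].
    exists (Z ++ T ++ N ++ L, T'). simpl. split; [exact cut|]. repeat split.
    - intros v h. apply in_or_app. auto.
    - intros v h. apply in_or_app. right. apply in_or_app. auto.
    - intros u v h e. do 2 (apply in_or_app; right). apply in_or_app. left.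
      apply HN. exists u. split; [apply in_or_app; exact h|exact e].
    - enough (length L <= 2 * length T') by lia.
      apply direction_count; [exact nd|]. intros t ht. split; [auto|].
      apply cut. do 3 (apply in_or_app; right). exact ht. }
  destruct (choice_on (fun _ => True) _ ([], []) H) as [f Hf].
  destruct (direction_nonempty []) as [v0 _].
  destruct (cuts_off_exists [v0]) as [T0 cut0].
  set (c := fun n => Nat.iter n f ([v0], T0)).
  assert (Hc : forall n, cuts_off (fst (c n)) (snd (c n))).
  { intros [|n]; [exact cut0|apply (Hf (c n) I)]. }
  exists (fun n => fst (c n)), (fun n => snd (c n)). split; [exact Hc|].
  do 4 (split; [intros n; apply (Hf (c n) I)|]).
  intros v.
  apply (reach_invariant adj _ (fun v => exists n, In v (fst (c n))) _ _ (reach_all v0 v)).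
  - exists 0. simpl. auto.
  - intros u w _ _ e [n hn]. exists (S n). apply (Hf (c n) I) with (u := u); auto.
Qed.

(** * Consecutive entries of a list *)

Definition consecutive (l : list V) (a b : V) := exists l1 l2, l = l1 ++ a :: b :: l2.

Lemma consecutive_cons x l a b : consecutive l a b -> consecutive (x :: l) a b.
Proof. intros (l1 & l2 & ->). exists (x :: l1), l2. reflexivity. Qed.

Lemma consecutive_in l a b : consecutive l a b -> In a l /\ In b l.
Proof. intros (l1 & l2 & ->). rewrite !in_app_iff. simpl. auto. Qed.

Lemma consecutive_inv x l a b : consecutive (x :: l) a b ->
  (x = a /\ exists l', l = b :: l') \/ consecutive l a b.
Proof.
  intros ([|y l1] & l2 & e); injection e as -> ->.
  - left. eauto.
  - right. exists l1, l2. reflexivity.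
Qed.

Lemma consecutive_functional l a b b' : NoDup l ->
  consecutive l a b -> consecutive l a b' -> b = b'.
Proof.
  induction l as [|x l IH]; intros nd h h'.
  - apply consecutive_in in h as [[] _].
  - inversion nd as [|? ? nx nd']. subst.
    apply consecutive_inv in h as [[-> [l1 e]]|h], h' as [[e' [l2 e'']]|h'].
    + congruence.
    + apply consecutive_in in h'. tauto.
    + subst a. apply consecutive_in in h. tauto.
    + auto.
Qed.

Lemma consecutive_injective l a a' b : NoDup l ->
  consecutive l a b -> consecutive l a' b -> a = a'.
Proof.
  induction l as [|x l IH]; intros nd h h'.
  - apply consecutive_in in h as [[] _].
  - inversion nd as [|? ? nx nd']. subst.
    apply consecutive_inv in h as [[-> [l1 e]]|h], h' as [[e' [l2 e'']]|h']; auto.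
    + exfalso. subst l. apply consecutive_inv in h' as [[-> [l2 ->]]|h'].
      * inversion nd'. simpl in *. tauto.
      * inversion nd'. apply consecutive_in in h'. tauto.
    + exfalso. subst l. apply consecutive_inv in h as [[-> [l1 ->]]|h].
      * inversion nd'. simpl in *. tauto.
      * inversion nd'. apply consecutive_in in h. tauto.
Qed.

Lemma rwalk_consecutive (R : V -> V -> Prop) a l b u v :
  rwalk R a l b -> consecutive l u v -> R u v.
Proof.
  intros w. induction w as [a|a c l b r w IH]; intros h.
  - apply consecutive_inv in h as [[_ [l' e]]|h]; [discriminate|].
    apply consecutive_in in h as [[] _].
  - apply consecutive_inv in h as [[-> [l' ->]]|h]; [|auto].
    destruct (rwalk_cases _ _ _ _ w) as [l'' e]. injection e as -> _. exact r.
Qed.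

Lemma rwalk_successor (R : V -> V -> Prop) a l b v :
  rwalk R a l b -> In v l -> v = b \/ exists w, consecutive l v w.
Proof.
  intros w. induction w as [a|a c l b r w IH]; intros h.
  - destruct h as [<-|[]]. auto.
  - destruct h as [<-|h].
    + right. exists c. destruct (rwalk_cases _ _ _ _ w) as [l' ->]. exists [], l'. reflexivity.
    + destruct (IH h) as [->|[x hx]]; [auto|right; exists x; auto using consecutive_cons].
Qed.

(** * Linkages between consecutive separators *)

Section Levels.
Variables Z T : nat -> list V.
Hypothesis T_cuts : forall n, cuts_off (Z n) (T n).
Hypothesis Z_incl : forall n, incl (Z n) (Z (S n)).
Hypothesis T_incl : forall n, incl (T n) (Z (S n)).
Hypothesis Z_adj : forall n u v, In u (Z n) \/ In u (T n) -> adj u v -> In v (Z (S n)).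
Hypothesis T_length : forall n, length (T n) < length (T (S n)).
Hypothesis Z_exhausts : forall v, exists n, In v (Z n).

Local Notation D n := (direction (T n)).

Lemma D_le m n v : m <= n -> D n v -> D m v.
Proof.
  induction 1 as [|n le IH]; [auto|]. intros h. apply IH.
  revert h. apply direction_antitone. intros x hx. apply T_cuts, T_incl, hx.
Qed.

(** x has a neighbour y beyond [T (S n)], hence beyond [T n]. If x were in [T n], then [Z_adj] would
    put y into [Z (S n)], which is cut off. This is why the sets Z absorb neighbourhoods. *)
Lemma T_succ_in_D n x : In x (T (S n)) -> D n x.
Proof.
  intros hx. destruct (cuts_off_adj _ _ _ (T_cuts (S n)) hx) as (y & hy & e).
  apply (direction_adj _ y); [exact (D_le n (S n) y ltac:(lia) hy)|auto|].
  intros h. apply (proj1 (T_cuts (S n)) y); [|exact hy].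
  apply (Z_adj n x); auto.
Qed.

Lemma T_in_D m n x : m < n -> In x (T n) -> D m x.
Proof.
  intros lt h. destruct n as [|n]; [lia|].
  apply (D_le m n); [lia|]. exact (T_succ_in_D n x h).
Qed.

(* The edges between two consecutive levels, directed away from [T n]; walks along
   them leave [T n] and stop as soon as they meet [T (S n)]. *)
Definition level_edge n (a b : V) :=
  adj a b /\ (In a (T n) \/ D n a) /\ ~ In a (T (S n)) /\ ~ D (S n) a /\
  D n b /\ ~ D (S n) b.

Lemma T_not_D_succ n x : In x (T n) -> ~ D (S n) x.
Proof. intros h. apply T_cuts, T_incl, h. Qed.

Lemma T_disjoint m n x : m < n -> In x (T m) -> ~ In x (T n).
Proof. intros lt h h'. exact (proj1 (T_in_D m n x lt h') h). Qed.

(** Such a Y also cuts [Z n] off from the end, so the minimality of [T n] bounds its length. *)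
Lemma level_unseparated n Y :
  separates (level_edge n) (fun v => In v (T n)) (fun v => In v (T (S n))) Y ->
  length (T n) <= length Y.
Proof.
  intros sep. apply T_cuts. intros z hz dz.
  destruct (direction_nonempty (Y ++ T (S n))) as [w hw].
  assert (wY : direction Y w).
  { revert hw. apply direction_antitone. intros x hx [nx _]. apply nx, in_or_app. auto. }
  assert (wT : D (S n) w).
  { revert hw. apply direction_antitone. intros x hx [nx _]. apply nx, in_or_app. auto. }
  assert (no_walk : forall a l b, In a (T n) -> rwalk (level_edge n) a l b ->
             (forall v, In v l -> ~ In v Y) -> ~ In b (T (S n))).
  { intros a l b ha r av hb. destruct (sep a l b ha hb r) as (v & hv & hl).
    exact (av v hl hv). }
  assert (nz : ~ D n z) by (apply T_cuts, hz).
  (* A walk from z that avoids Y can enter [D n] only through [T n]. From there it continues as a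
     level walk, which Y keeps from reaching [T (S n)] and hence from entering [D (S n)]. *)
  assert (K : ~ D n w \/ (~ D (S n) w /\ ~ In w (T (S n)) /\
      exists a l, In a (T n) /\ rwalk (level_edge n) a l w /\ forall v, In v l -> ~ In v Y)).
  { apply (reach_invariant adj _ (fun w => ~ D n w \/ (~ D (S n) w /\ ~ In w (T (S n)) /\
      exists a l, In a (T n) /\ rwalk (level_edge n) a l w /\ forall v, In v l -> ~ In v Y))
      _ _ (direction_connected Y z w dz wY)); [auto|].
    intros u v nu nv e h. destruct (classic (D n v)) as [dv|]; [right|auto].
    assert (step : forall a l, In a (T n) -> rwalk (level_edge n) a l u ->
       (forall x, In x l -> ~ In x Y) -> level_edge n u v ->
       ~ D (S n) v /\ ~ In v (T (S n)) /\
       exists a l, In a (T n) /\ rwalk (level_edge n) a l v /\ forall x, In x l -> ~ In x Y).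
    { intros a l ha r av le.
      assert (r' : rwalk (level_edge n) a (l ++ [v]) v)
        by (eapply rwalk_link; [exact r|exact le|constructor]).
      assert (av' : forall x, In x (l ++ [v]) -> ~ In x Y).
      { intros x hx. apply in_app_or in hx as [hx|[<-|[]]]; auto. }
      split; [apply le|]. split; [exact (no_walk _ _ _ ha r' av')|eauto]. }
    destruct h as [du|(du & tu & a & l & ha & r & av)].
    - assert (hu : In u (T n)).
      { apply NNPP. intros h. apply du. apply (direction_adj _ v u dv); auto. }
      apply (step u [u] hu).
      + constructor.
      + intros x [<-|[]]. exact nu.
      + repeat split; auto; try apply dv.
        * intros h. apply (T_disjoint n (S n) u); auto.
        * apply T_not_D_succ, hu.
        * apply T_cuts. apply (Z_adj n u v); auto.
    - apply (step a l ha r av).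
      assert (Tu : In u (T n) \/ D n u).
      { clear - r ha. destruct r as [|u' w' l' u'' q r]; [auto|right].
        revert r q. clear. intros r. revert u'.
        induction r as [x|x y l z q' r IH]; intros u' q; [apply q|exact (IH x q')]. }
      repeat split; auto; try apply dv.
      intros h. apply du. apply (direction_adj _ v u h); auto. }
  destruct K as [h|[h _]]; [|tauto].
  apply h. exact (D_le n (S n) w ltac:(lia) wT).
Qed.

Lemma level_paths n : exists p : V -> list V,
  (forall t, In t (T n) -> exists b, In b (T (S n)) /\
     rwalk (level_edge n) t (p t) b /\ NoDup (p t)) /\
  (forall t t' v, In t (T n) -> In t' (T n) -> In v (p t) -> In v (p t') -> t = t').
Proof.
  destruct (linkage_reindex _ _ _ _ (T n) (fun t a b => t = a)
              (fun a b ha _ => ex_intro _ a (conj ha eq_refl)) (fun t a b e => or_introl e)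
              eq_refl (menger _ _ _ _ (level_unseparated n))) as (p & Hp & dis).
  exists p. split; [|exact dis].
  intros t ht. destruct (Hp t ht) as (a & b & ha & hb & -> & h). eauto.
Qed.

(** * Gluing the linkages into disjoint rays *)

Section Paths.
Variable p : nat -> V -> list V.
Hypothesis p_path : forall n t, In t (T n) -> exists b, In b (T (S n)) /\
  rwalk (level_edge n) t (p n t) b /\ NoDup (p n t).
Hypothesis p_disjoint : forall n t t' v,
  In t (T n) -> In t' (T n) -> In v (p n t) -> In v (p n t') -> t = t'.

(** One step along a path of any level. As [next] is functional and injective across all levels, the
    rays can be taken as its forward orbits. *)
Definition next v w := exists n t, In t (T n) /\ consecutive (p n t) v w.
Definition on_paths v := exists n t, In t (T n) /\ In v (p n t).

Lemma next_edge n t v w : In t (T n) -> consecutive (p n t) v w -> level_edge n v w.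
Proof.
  intros ht h. destruct (p_path n t ht) as (b & _ & r & _).
  exact (rwalk_consecutive _ _ _ _ _ _ r h).
Qed.

Lemma next_adj v w : next v w -> adj v w.
Proof. intros (n & t & ht & h). apply (next_edge n t v w ht h). Qed.

(** With [level_edge_target], this shows that either end of an edge determines its level. Sources of
    level n lie in [T n] or [D n] but not in [T (S n)] or [D (S n)], targets in [D n] but not in
    [D (S n)]; such regions are disjoint for different n. *)
Lemma level_edge_source m n a b b' : level_edge m a b -> level_edge n a b' -> n <= m.
Proof.
  intros (_ & _ & nt & nd & _) (_ & h & _).
  destruct (le_lt_dec n m) as [le|lt]; [exact le|exfalso].
  destruct h as [h|h]; [|apply nd; exact (D_le (S m) n a lt h)].
  destruct (Nat.eq_dec (S m) n) as [<-|ne]; [auto|].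
  apply nd. apply (T_in_D (S m) n); [lia|exact h].
Qed.

Lemma level_edge_target m n a a' b : level_edge m a b -> level_edge n a' b -> n <= m.
Proof.
  intros (_ & _ & _ & _ & _ & nd) (_ & _ & _ & _ & d & _).
  destruct (le_lt_dec n m) as [le|lt]; [exact le|exfalso].
  apply nd. exact (D_le (S m) n b lt d).
Qed.

Lemma next_functional v w w' : next v w -> next v w' -> w = w'.
Proof.
  intros (n & t & ht & h) (n' & t' & ht' & h').
  pose proof (next_edge _ _ _ _ ht h) as e. pose proof (next_edge _ _ _ _ ht' h') as e'.
  assert (n = n') as <- by (apply Nat.le_antisymm; eapply level_edge_source; eauto).
  assert (t = t') as <-.
  { apply (p_disjoint n t t' v); auto;
      [apply (consecutive_in _ _ _ h)|apply (consecutive_in _ _ _ h')]. }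
  destruct (p_path n t ht) as (b & _ & _ & nd).
  exact (consecutive_functional _ _ _ _ nd h h').
Qed.

Lemma next_injective v v' w : next v w -> next v' w -> v = v'.
Proof.
  intros (n & t & ht & h) (n' & t' & ht' & h').
  pose proof (next_edge _ _ _ _ ht h) as e. pose proof (next_edge _ _ _ _ ht' h') as e'.
  assert (n = n') as <- by (apply Nat.le_antisymm; eapply level_edge_target; eauto).
  assert (t = t') as <-.
  { apply (p_disjoint n t t' w); auto;
      [apply (consecutive_in _ _ _ h)|apply (consecutive_in _ _ _ h')]. }
  destruct (p_path n t ht) as (b & _ & _ & nd).
  exact (consecutive_injective _ _ _ _ nd h h').
Qed.

Lemma T_on_paths n t : In t (T n) -> on_paths t.
Proof.
  intros ht. exists n, t. split; [exact ht|].
  destruct (p_path n t ht) as (b & _ & r & _). exact (rwalk_start _ _ _ _ r).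
Qed.

Lemma on_paths_next v : on_paths v -> exists w, next v w /\ on_paths w.
Proof.
  assert (K : forall n t v w, In t (T n) -> consecutive (p n t) v w -> next v w /\ on_paths w).
  { intros n t a b ht h. split; exists n, t; auto.
    split; [exact ht|]. apply (consecutive_in _ _ _ h). }
  intros (n & t & ht & hv). destruct (p_path n t ht) as (b & hb & r & _).
  destruct (rwalk_successor _ _ _ _ _ r hv) as [->|[w h]]; [|exists w; eauto].
  (* At the last vertex of its path, v moves on to the path of the next level that starts there;
     this path is not trivial because the sets T are disjoint. *)
  destruct (p_path (S n) b hb) as (c & hc & r' & _).
  destruct (rwalk_successor _ _ _ _ _ r' (rwalk_start _ _ _ _ r')) as [e|[w h]];
    [|exists w; eauto].
  subst c. exfalso. exact (T_disjoint (S n) (S (S n)) b ltac:(lia) hb hc).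
Qed.

(** The paths of level n have fewer ends than [T (S n)] has vertices. A missed vertex x has no
    predecessor: an edge into x is of level n, and a path of level n through x must end in x. *)
Lemma start_exists n : exists x, In x (T (S n)) /\ forall v, ~ next v x.
Proof.
  assert (H : forall t, In t (T n) -> exists b, In b (T (S n)) /\
            rwalk (level_edge n) t (p n t) b /\ NoDup (p n t)) by apply p_path.
  destruct (direction_nonempty []) as [v0 _].
  destruct (choice_on _ _ v0 H) as [e He].
  assert (exists x, In x (T (S n)) /\ ~ In x (map e (T n))) as (x & hx & nx).
  { apply NNPP. intros no.
    assert (inc : incl (T (S n)) (map e (T n))).
    { intros x hx. apply NNPP. intros h. apply no. eauto. }
    apply NoDup_incl_length in inc; [|eapply cuts_off_NoDup; apply T_cuts].
    rewrite length_map in inc. pose proof (T_length n). lia. }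
  exists x. split; [exact hx|]. intros v (m & t & ht & h).
  pose proof (next_edge _ _ _ _ ht h) as (_ & _ & _ & _ & dx & ndx).
  assert (m = n) as ->.
  { destruct (Nat.lt_trichotomy m n) as [lt|[e'|lt]]; [exfalso|exact e'|exfalso].
    - apply ndx. exact (T_in_D (S m) (S n) x ltac:(lia) hx).
    - apply (D_le (S n) m) in dx; [|lia]. exact (proj1 dx hx). }
  destruct (He t ht) as (_ & r & _).
  destruct (rwalk_successor _ _ _ _ x r) as [->|[w h']].
  - apply (consecutive_in _ _ _ h).
  - apply nx, in_map, ht.
  - pose proof (next_edge _ _ _ _ ht h') as (_ & _ & nTx & _). exact (nTx hx).
Qed.

Section Orbits.
Variable nx : V -> V.
Hypothesis nx_next : forall v, on_paths v -> next v (nx v) /\ on_paths (nx v).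

Definition orbit (x : V) (j : nat) := Nat.iter j nx x.

Lemma orbit_on x j : on_paths x -> on_paths (orbit x j).
Proof. intros h. induction j as [|j IH]; [exact h|]. apply (nx_next _ IH). Qed.

Lemma orbit_next x j : on_paths x -> next (orbit x j) (orbit x (S j)).
Proof. intros h. apply (nx_next _ (orbit_on x j h)). Qed.

Lemma orbit_add x i j : orbit x (i + j) = orbit (orbit x j) i.
Proof. unfold orbit. apply Nat.iter_add. Qed.

Lemma orbit_cancel x y i d : on_paths x -> on_paths y ->
  orbit x i = orbit y (i + d) -> x = orbit y d.
Proof.
  intros hx hy. induction i as [|i IH]; intros e; [exact e|].
  apply IH. apply (next_injective _ _ (orbit x (S i))).
  - apply orbit_next, hx.
  - rewrite e. apply orbit_next, hy.
Qed.

(** By injectivity both orbits can be traced back together until one is at its start, which has no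
    predecessor. The case x = y shows that an orbit never repeats a vertex. *)
Lemma orbit_meet x y i j : on_paths x -> on_paths y ->
  (forall v, ~ next v x) -> (forall v, ~ next v y) -> orbit x i = orbit y j -> x = y /\ i = j.
Proof.
  assert (K : forall x y i d, on_paths x -> on_paths y -> (forall v, ~ next v x) ->
            orbit x i = orbit y (i + d) -> x = y /\ d = 0).
  { intros a b k d ha hb na e. apply orbit_cancel in e; auto.
    destruct d as [|d]; [auto|]. exfalso. apply (na (orbit b d)).
    rewrite e. apply orbit_next, hb. }
  intros hx hy sx sy e. destruct (le_lt_dec i j) as [le|lt].
  - replace j with (i + (j - i)) in e by lia.
    destruct (K x y i (j - i) hx hy sx e). split; [auto|lia].
  - symmetry in e. replace i with (j + (i - j)) in e by lia.
    destruct (K y x j (i - j) hy hx sy e). split; [auto|lia].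
Qed.

Lemma orbit_ray x : on_paths x -> (forall v, ~ next v x) -> is_ray V adj (orbit x).
Proof.
  intros hx sx. split.
  - intros m n e. apply (orbit_meet x x m n); auto.
  - intros n. apply next_adj, orbit_next, hx.
Qed.

Lemma orbit_level n x : In x (T n) -> exists j, In (orbit x j) (T (S n)).
Proof.
  intros hx. destruct (p_path n x hx) as (b & hb & r & _).
  enough (K : forall a l c, rwalk (level_edge n) a l c ->
            (forall u v, consecutive l u v -> consecutive (p n x) u v) ->
            on_paths a -> exists j, orbit a j = c).
  { destruct (K x (p n x) b r) as [j e]; auto; [exact (T_on_paths n x hx)|].
    exists j. now rewrite e. }
  clear r hb b. intros a l c r. induction r as [a|a b l c e r IH]; intros H ha.
  - exists 0. reflexivity.
  - destruct (rwalk_cases _ _ _ _ r) as [l' ->].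
    assert (nab : next a b).
    { exists n, x. split; [exact hx|]. apply H. exists [], l'. reflexivity. }
    destruct (nx_next a ha) as [na oa].
    assert (eb : nx a = b) by (eapply next_functional; eauto).
    destruct IH as [j hj].
    + intros u v h. apply H, consecutive_cons, h.
    + now rewrite <- eb.
    + exists (j + 1). rewrite orbit_add. simpl. now rewrite eb.
Qed.

(** An edge with source in [D N] has level at least N, because sources of level m lie outside
    [D (S m)]; so its target is again in [D N]. *)
Lemma orbit_D N x i j : on_paths x -> i <= j -> D N (orbit x i) -> D N (orbit x j).
Proof.
  intros hx le hi. induction le as [|j le IH]; [exact hi|].
  destruct (orbit_next x j hx) as (m & t & ht & h).
  pose proof (next_edge _ _ _ _ ht h) as (_ & _ & _ & nd & dw & _).
  destruct (le_lt_dec N m) as [l|l]; [exact (D_le N m _ l dw)|].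
  exfalso. apply nd. exact (D_le (S m) N _ l IH).
Qed.

Lemma orbit_converges n x : In x (T n) -> converges (orbit x).
Proof.
  intros hx S. pose proof (T_on_paths n x hx) as ox.
  assert (exists N, incl S (Z N)) as [N HN].
  { induction S as [|v S [N HN]]; [exists 0; intros v []|].
    destruct (Z_exhausts v) as [k hk].
    assert (mono : forall i j, i <= j -> incl (Z i) (Z j)).
    { intros i j le. induction le; [apply incl_refl|].
      eapply incl_tran; [eassumption|apply Z_incl]. }
    exists (max N k). intros w [<-|hw].
    - apply (mono k); [lia|exact hk].
    - apply (mono N); [lia|auto]. }
  assert (L : forall d, exists j, In (orbit x j) (T (n + d))).
  { induction d as [|d [j hj]].
    - exists 0. now rewrite Nat.add_0_r.
    - destruct (orbit_level _ _ hj) as [i hi]. exists (i + j).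
      rewrite orbit_add, Nat.add_succ_r. exact hi. }
  (* The index must exceed N even for n = 0, since [T N] itself is not contained in [D N]. *)
  destruct (L (N + 1)) as [m hm]. exists m. intros j hj.
  apply (direction_antitone S (T N)).
  - intros v hv. apply T_cuts, HN, hv.
  - apply (orbit_D N x m j ox hj). apply (T_in_D N (n + (N + 1))); [lia|exact hm].
Qed.

End Orbits.
End Paths.
End Levels.

Lemma disjoint_converging_rays : exists Rs : nat -> nat -> V,
  (forall i, is_ray V adj (Rs i) /\ converges (Rs i)) /\
  (forall i j, i <> j -> forall m n, Rs i m <> Rs j n).
Proof.
  destruct levels_exist as (Z & T & cut & Zi & Ti & Za & Tl & Ze).
  destruct (direction_nonempty []) as [v0 _].
  destruct (choice_on (fun _ => True) _ (fun _ => [])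
              (fun n _ => level_paths Z T cut Ti Za n)) as [p Hp].
  assert (pp : forall n t, In t (T n) -> exists b, In b (T (S n)) /\
    rwalk (level_edge T n) t (p n t) b /\ NoDup (p n t)) by (intros n; apply (Hp n I)).
  assert (pd : forall n t t' v, In t (T n) -> In t' (T n) ->
    In v (p n t) -> In v (p n t') -> t = t') by (intros n; apply (Hp n I)).
  destruct (choice_on _ _ v0 (on_paths_next Z T cut Ti Za p pp)) as [nx Hnx].
  destruct (choice_on (fun _ => True) _ v0
              (fun n _ => start_exists Z T cut Ti Za Tl p pp n)) as [x Hx].
  assert (xT : forall i, In (x i) (T (S i))) by (intros i; apply (Hx i I)).
  assert (xs : forall i v, ~ next T p v (x i)) by (intros i; apply (Hx i I)).
  assert (xo : forall i, on_paths T p (x i)).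
  { intros i. exact (T_on_paths T p pp (S i) _ (xT i)). }
  exists (fun i => orbit nx (x i)). split.
  - intros i. split.
    + apply (orbit_ray Z T cut Ti p pp pd nx Hnx); auto.
    + apply (orbit_converges Z T cut Zi Ti Za Ze p pp pd nx Hnx (S i)); auto.
  - intros i j ne m n e.
    (* Orbits that meet have the same start, but the starts lie in different, hence disjoint,
       separators. *)
    assert (exy : x i = x j).
    { eapply (orbit_meet Z T cut Ti p pp pd nx Hnx); eauto. }
    pose proof (xT i) as hi. pose proof (xT j) as hj. rewrite exy in hi.
    destruct (Nat.lt_gt_cases i j) as [K _]. destruct (K ne) as [lt|lt].
    + exact (T_disjoint Z T cut Ti Za (S i) (S j) _ ltac:(lia) hi hj).
    + exact (T_disjoint Z T cut Ti Za (S j) (S i) _ ltac:(lia) hj hi).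
Qed.

End Direction.
End Graph.

Theorem theorem2 (V : Type) (adj : V -> V -> Prop)
  (Hsimple : simple_graph V adj)
  (Hconn : connected V adj)
  (Hlf : locally_finite V adj)
  (N : osep V -> Prop) (HN : tree_of_tangles V adj N)
  (s : nat -> osep V)
  (Hinc : forall i, olt (s i) (s (S i)))
  (HinN : forall i, sep_in N (s i))
  (HB : exists v, snd (lim_sep s) v) :
  exists om : (nat -> V) -> Prop,
    is_end V adj om /\
    in_closure V adj om (fun v => fst (lim_sep s) v /\ snd (lim_sep s) v) /\
    (forall om', is_end V adj om' ->
       in_closure V adj om' (fun v => fst (lim_sep s) v /\ snd (lim_sep s) v) ->
       forall R, om' R <-> om R) /\
    thick V om.
Proof.
  destruct Hsimple as [adj_sym _].
  assert (eff : forall i, exists n, @efficient V adj n (fst (s i)) (snd (s i))).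
  { intros i. destruct HN as (_ & _ & H).
    destruct (H (s i) (HinN i)) as (P & Q & tP & tQ & h).
    exact (eff_distinguishes_efficient P Q (s i) tP tQ h). }
  pose proof (limit_separator_infinite adj_sym Hconn Hlf s Hinc eff HB) as inf.
  pose proof (limit_separator_unsplit adj_sym s Hinc eff) as unsplit.
  destruct (disjoint_converging_rays adj_sym Hconn Hlf _ inf unsplit) as (Rs & HRs & dis).
  destruct (HRs 0) as [r0 c0].
  exists (fun R => is_ray V adj R /\ @converges V adj (limit_separator s) R).
  split; [|split; [|split]].
  - exists (Rs 0). split; [exact r0|]. intros R.
    split; intros [r h]; split; auto.
    + exact (converges_equiv adj_sym _ unsplit _ _ c0 h).
    + exact (equiv_converges adj_sym _ _ _ r0 r c0 h).
  - destruct (converges_comb _ (Rs 0) r0 c0) as [P comb].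
    exists (Rs 0), P. auto.
  - intros om' h h' R. exact (end_in_closure adj_sym _ unsplit om' h h' R).
  - exists Rs. auto.
Qed.
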